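(* Let $M$ be an irreducible affine algebraic monoid over an algebraically closed field $\Bbbk$, with unit group $G$, and let $H\subset G$ be a subgroup that is closed in $M$. Then the following conditions are equivalent. (1) $H$ is observable in $M$. (2) $E_M(H)$ is a group; that is, for every $\rho\in E_M(H)$ one has $\rho^{-1}\in E_M(H)$. (3) $E_M(H)=\mathcal X(H)$; that is, every rational character of $H$ is extendible. (4) For every finite dimensional rational right $H$-module $V$ there exist a finite dimensional rational right $M$-module $W$ and an injective morphism of $H$-modules $\xi:V\to W|_{H}$. (5) $H$ is observable in $G$ and, for any (equivalently, for some) determinant $\det:M\to\Bbbk$, the character $\frac{1}{\det}\big|_{H}$ belongs to $E_M(H)$.
   Context: An algebraic monoid is an algebraic variety $M$ with an associative product $M\times M\to M$ that is a morphism of varieties and has a neutral element $1$. Its unit group $G=G(M)$ is an algebraic group, open in $M$. For $f\in\Bbbk[M]$ and $x\in M$ put $(f\cdot x)(m)=f(xm)$, and likewise for $f\in\Bbbk[G]$, $x\in G$. $(\ )^H$ denotes invariants for the resulting right action of $H$. An action of an affine algebraic group $H$ on an affine variety $X$ is observable if every nonzero $H$-stable ideal $I\subset\Bbbk[X]$ satisfies $I^H\neq(0)$. A closed subgroup $H\subset G$ is observable in $M$ (resp. in $G$) if the action of $H$ on $M$ (resp. on $G$) by left multiplication is observable. $\mathcal X(H)$ is the group of rational characters $H\to\Bbbk^*$. A character $\chi\in\mathcal X(H)$ is extendible if there is a nonzero $f\in\Bbbk[M]$ with $f\cdot x=\chi(x)f$ for all $x\in H$. $E_M(H)\subset\mathcal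 X(H)$ is the monoid of extendible characters (it contains the trivial character). A determinant of $M$ is a morphism of algebraic monoids $\det:M\to\Bbbk$ (with $\Bbbk$ under multiplication) such that $\det^{-1}(0)=M\setminus G$. Determinants always exist. A finite dimensional rational right $M$-module is a finite dimensional $\Bbbk$-vector space $W$ with a right action $W\times M\to W$ of $M$ by linear endomorphisms that is a morphism of varieties and in which $1$ acts as the identity. Rational right $H$-modules are defined similarly. $W|_H$ is the restriction of $W$ to $H$. *)

(* Defs.v *)
From HB Require Import structures.
From mathcomp Require Import all_boot all_algebra.
From mathcomp Require Import mpoly.
From Stdlib Require Import ProofIrrelevance.

Set Implicit Arguments.
Unset Strict Implicit.
Unset Printing Implicit Defensive.

Import GRing.Theory.
Local Open Scope ring_scope.

(* An affine variety is a type with a bijection onto a Zariski-closed subset of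
   some k^n.  The notions below depend on the embedding only through the
   coordinate ring [regular]. *)
Record affine (k : closedFieldType) (T : Type) := Affine {
  adim : nat;
  aemb : T -> 'rV[k]_adim;
  aemb_inj : injective aemb;
  aemb_closed : exists S : {mpoly k[adim]} -> Prop,
    forall v, (exists x, aemb x = v) <-> (forall p, S p -> p.@[v 0] = 0) }.

Section Varieties.
Context (k : closedFieldType).
Implicit Types T U : Type.

(* [regular X f]: f belongs to k[X]. *)
Definition regular T (X : affine k T) (f : T -> k) : Prop :=
  exists p : {mpoly k[adim X]}, forall x, f x = p.@[aemb X x 0].

Definition zclosed T (X : affine k T) (A : T -> Prop) : Prop :=
  exists S : {mpoly k[adim X]} -> Prop,
    forall x, A x <-> (forall p, S p -> p.@[aemb X x 0] = 0).

Definition zopen T (X : affine k T) (A : T -> Prop) : Prop :=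
  zclosed X (fun x => ~ A x).

Definition zirreducible T (X : affine k T) : Prop :=
  inhabited T /\
  forall A B, zclosed X A -> zclosed X B -> (forall x, A x \/ B x) ->
    (forall x, A x) \/ (forall x, B x).

Definition var_morphism T U (X : affine k T) (Y : affine k U) (phi : T -> U) : Prop :=
  forall f, regular Y f -> regular X (fun x => f (phi x)).

(* Regular functions on an open subvariety: locally quotients of regular
   functions on the ambient affine variety. *)
Definition regular_open T (X : affine k T) (A : T -> Prop)
    (f : {x : T | A x} -> k) : Prop :=
  forall x : {x : T | A x}, exists V : T -> Prop, exists p q : T -> k,
    [/\ zopen X V /\ V (sval x), forall y, V y -> A y,
        regular X p /\ regular X q
      & forall y : {x : T | A x}, V (sval y) ->
          q (sval y) != 0 /\ f y = p (sval y) / q (sval y)].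

Section Product.
Context (T U : Type) (X : affine k T) (Y : affine k U).

Definition prod_emb (z : T * U) : 'rV[k]_(adim X + adim Y) :=
  row_mx (aemb X z.1) (aemb Y z.2).

Lemma prod_emb_inj : injective prod_emb.
Proof.
move=> [x y] [x' y']; rewrite /prod_emb /= => /eq_row_mx[ex ey].
by rewrite (aemb_inj ex) (aemb_inj ey).
Qed.

Lemma prod_emb_closed : exists S : {mpoly k[adim X + adim Y]} -> Prop,
  forall v, (exists z, prod_emb z = v) <-> (forall p, S p -> p.@[v 0] = 0).
Proof.
have [SX hX] := aemb_closed X; have [SY hY] := aemb_closed Y.
pose lX := [tuple 'X_(lshift (adim Y) i) : {mpoly k[adim X + adim Y]} | i < adim X].
pose lY := [tuple 'X_(rshift (adim X) i) : {mpoly k[adim X + adim Y]} | i < adim Y].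
have eX (v : 'rV[k]_(adim X + adim Y)) p : (p \mPo lX).@[v 0] = p.@[lsubmx v 0].
  rewrite comp_mpoly_meval; apply: meval_eq => i.
  by rewrite tnth_mktuple mevalXU mxE.
have eY (v : 'rV[k]_(adim X + adim Y)) p : (p \mPo lY).@[v 0] = p.@[rsubmx v 0].
  rewrite comp_mpoly_meval; apply: meval_eq => i.
  by rewrite tnth_mktuple mevalXU mxE.
exists (fun q => (exists2 p, SX p & q = p \mPo lX) \/
                 (exists2 p, SY p & q = p \mPo lY)) => v; split.
- move=> [[x y] <-] q; rewrite /prod_emb /=; case=> [[p Sp ->]|[p Sp ->]].
  + by rewrite eX row_mxKl; apply: ((hX _).1 _ p Sp); exists x.
  + by rewrite eY row_mxKr; apply: ((hY _).1 _ p Sp); exists y.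
- move=> h.
  have [x hx] : exists x, aemb X x = lsubmx v.
    by apply/hX => p Sp; rewrite -eX; apply: h; left; exists p.
  have [y hy] : exists y, aemb Y y = rsubmx v.
    by apply/hY => p Sp; rewrite -eY; apply: h; right; exists p.
  by exists (x, y); rewrite /prod_emb /= hx hy hsubmxK.
Qed.

Definition affine_prod : affine k (T * U) := Affine prod_emb_inj prod_emb_closed.

End Product.

Section Closed.
Context (T : Type) (X : affine k T) (A : T -> Prop) (hA : zclosed X A).

Definition sub_emb (x : {x : T | A x}) : 'rV[k]_(adim X) := aemb X (sval x).

Lemma sub_emb_inj : injective sub_emb.
Proof.
move=> [x hx] [y hy]; rewrite /sub_emb /= => e.
have exy := aemb_inj e; clear e; subst y.
by rewrite (proof_irrelevance _ hx hy).
Qed.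

Lemma sub_emb_closed : exists S : {mpoly k[adim X]} -> Prop,
  forall v, (exists z, sub_emb z = v) <-> (forall p, S p -> p.@[v 0] = 0).
Proof.
have [SX hX] := aemb_closed X; have [SA hSA] := hA.
exists (fun p => SX p \/ SA p) => v; split.
- move=> [[x hx] <-] p; rewrite /sub_emb /=; case=> Sp.
  + by apply: ((hX _).1 _ p Sp); exists x.
  + exact: (hSA x).1.
- move=> h; have [|x hx] := (hX v).2; first by move=> p Sp; apply: h; left.
  have Ax : A x by apply/hSA => p Sp; rewrite hx; apply: h; right.
  by exists (exist _ x Ax).
Qed.

Definition affine_closed : affine k {x : T | A x} :=
  Affine sub_emb_inj sub_emb_closed.

End Closed.

Section Space.
Context (V : vectType k).

Lemma fullv_basis : basis_of {:V} (vbasis {:V}).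
Proof. exact: vbasisP. Qed.

Lemma vect_emb_inj : injective (passmx.rVof (vbasis {:V})).
Proof. exact: can_inj (passmx.rVofK fullv_basis). Qed.

Lemma vect_emb_closed : exists S : {mpoly k[\dim {:V}]} -> Prop, forall v,
  (exists x, passmx.rVof (vbasis {:V}) x = v) <-> (forall p, S p -> p.@[v 0] = 0).
Proof.
exists (fun=> False) => v; split=> // _.
by exists (passmx.vecof (vbasis {:V}) v); rewrite (passmx.vecofK fullv_basis).
Qed.

Definition affine_vect : affine k V := Affine vect_emb_inj vect_emb_closed.

End Space.

End Varieties.

Record algMonoid (k : closedFieldType) := AlgMonoid {
  am_sort :> Type;
  am_var : affine k am_sort;
  am_mul : am_sort -> am_sort -> am_sort;
  am_one : am_sort;
  am_mulA : forall x y z, am_mul x (am_mul y z) = am_mul (am_mul x y) z;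
  am_mul1m : forall x, am_mul am_one x = x;
  am_mulm1 : forall x, am_mul x am_one = x;
  am_morph : var_morphism (affine_prod am_var am_var) am_var
               (fun z => am_mul z.1 z.2) }.

Arguments am_one {k a}.

Declare Scope am_scope.
Delimit Scope am_scope with M.
Notation "x * y" := (am_mul x y) : am_scope.
Notation "1" := am_one : am_scope.

Definition coord_ring (k : closedFieldType) (M : algMonoid k) : (M -> k) -> Prop :=
  regular (am_var M).

Section Monoids.
Context (k : closedFieldType) (M : algMonoid k).

Definition am_unit (x : M) : Prop :=
  exists y : M, (x * y = 1)%M /\ (y * x = 1)%M.

Lemma am_unit_mul x y : am_unit x -> am_unit y -> am_unit (x * y)%M.
Proof.
move=> [x' [xx' x'x]] [y' [yy' y'y]]; exists (y' * x')%M.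
split.
  by rewrite am_mulA -(am_mulA x y y') yy' am_mulm1.
by rewrite am_mulA -(am_mulA y' x' x) x'x am_mulm1.
Qed.

Record closed_subgroup (H : M -> Prop) : Prop := ClosedSubgroup {
  cs_unit : forall x, H x -> am_unit x;
  cs_one : H 1%M;
  cs_mul : forall x y, H x -> H y -> H (x * y)%M;
  cs_inv : forall x y, H x -> (x * y = 1)%M -> H y;
  cs_closed : zclosed (am_var M) H }.

Definition is_determinant (d : M -> k) : Prop :=
  [/\ coord_ring d, d 1%M = 1, forall x y, d (x * y)%M = d x * d y
    & forall x, d x = 0 <-> ~ am_unit x].

Section Subgroup.
Context (H : M -> Prop) (hH : closed_subgroup H).
Local Notation S := {x : M | H x}.
Local Notation SX := (affine_closed (cs_closed hH)).

Definition smul (x y : S) : S :=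
  exist H (sval x * sval y)%M (cs_mul hH (svalP x) (svalP y)).
Definition sone : S := exist H 1%M (cs_one hH).

Lemma S_eq (x y : S) : sval x = sval y -> x = y.
Proof. by move=> e; apply: (@aemb_inj _ _ SX); rewrite /= /sub_emb e. Qed.

Lemma smulA x y z : smul x (smul y z) = smul (smul x y) z.
Proof. by apply: S_eq; rewrite /= am_mulA. Qed.
Lemma smul1 x : smul sone x = x.
Proof. by apply: S_eq; rewrite /= am_mul1m. Qed.
Lemma s1mul x : smul x sone = x.
Proof. by apply: S_eq; rewrite /= am_mulm1. Qed.
Lemma smorph : var_morphism (affine_prod SX SX) SX (fun z => smul z.1 z.2).
Proof.
move=> f [p hp].
have [|q hq] := am_morph (f := fun x : M => p.@[aemb (am_var M) x 0]).
  by exists p.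
by exists q => -[x y]; rewrite hp /= (hq (sval x, sval y)).
Qed.

Definition subgroup_monoid : algMonoid k := AlgMonoid smulA smul1 s1mul smorph.

(* The character group X(H).  A morphism to the open subvariety k^* of k is a
   regular function without zeros. *)
Definition is_character (chi : subgroup_monoid -> k) : Prop :=
  [/\ coord_ring chi, forall x, chi x != 0
    & forall x y, chi (x * y)%M = chi x * chi y].

(* The monoid E_M(H). *)
Definition extendible (chi : subgroup_monoid -> k) : Prop :=
  is_character chi /\
  exists f : M -> k, [/\ coord_ring f, exists m, f m != 0
    & forall (x : subgroup_monoid) (m : M), f (sval x * m)%M = chi x * f m].

End Subgroup.
End Monoids.

(* A family [act] of transformations of a space T with ring of functions A is
   observable.  (f . s)(t) = f (act s t). *)
Section Observable.
Context (k : closedFieldType) (T S : Type) (A : (T -> k) -> Prop) (act : S -> T -> T).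

Definition is_ideal (I : (T -> k) -> Prop) : Prop :=
  [/\ forall f, I f -> A f, I (fun=> 0),
      forall f g, I f -> I g -> I (fun t => f t + g t)
    & forall f g, A f -> I g -> I (fun t => f t * g t)].

Definition nonzero (I : (T -> k) -> Prop) : Prop :=
  exists2 f, I f & exists t, f t != 0.

Definition observable_action : Prop :=
  forall I, is_ideal I -> nonzero I ->
    (forall s f, I f -> I (fun t => f (act s t))) ->
    nonzero (fun f => I f /\ forall s t, f (act s t) = f t).

End Observable.

Section ObservableSubgroup.
Context (k : closedFieldType) (M : algMonoid k) (H : M -> Prop).
Context (hH : closed_subgroup H).

Definition observable_monoid : Prop :=
  observable_action (@coord_ring k M)
    (fun (x : subgroup_monoid hH) (m : M) => (sval x * m)%M).

Definition am_unit_lmul (x : subgroup_monoid hH) (g : {g : M | am_unit g}) :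
    {g : M | am_unit g} :=
  exist (@am_unit k M) (sval x * sval g)%M
    (am_unit_mul (cs_unit hH (svalP x)) (svalP g)).

Definition observable_units : Prop :=
  observable_action (@regular_open k M (am_var M) (@am_unit k M)) am_unit_lmul.

End ObservableSubgroup.

Record ratModule (k : closedFieldType) (N : algMonoid k) := RatModule {
  rm_sort :> vectType k;
  rm_act : rm_sort -> N -> rm_sort;
  rm_linear : forall x, linear (rm_act^~ x);
  rm_act1 : forall v, rm_act v 1%M = v;
  rm_actM : forall v x y, rm_act v (x * y)%M = rm_act (rm_act v x) y;
  rm_morph : var_morphism (affine_prod (affine_vect rm_sort) (am_var N))
               (affine_vect rm_sort) (fun z => rm_act z.1 z.2) }.

Section Restriction.
Context (k : closedFieldType) (M : algMonoid k) (H : M -> Prop).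
Context (hH : closed_subgroup H) (W : ratModule M).

Definition ract (v : W) (x : subgroup_monoid hH) : W := rm_act v (sval x).

Lemma ract_linear x : linear (ract^~ x).
Proof. exact: rm_linear. Qed.
Lemma ract1 v : ract v 1%M = v.
Proof. exact: rm_act1. Qed.
Lemma ractM v x y : ract v (x * y)%M = ract (ract v x) y.
Proof. exact: rm_actM. Qed.
Lemma ract_morph : var_morphism (affine_prod (affine_vect W) (am_var (subgroup_monoid hH)))
  (affine_vect W) (fun z => ract z.1 z.2).
Proof. by move=> f /rm_morph[q hq]; exists q => -[v x]; apply: (hq (v, sval x)). Qed.

Definition module_restriction : ratModule (subgroup_monoid hH) :=
  RatModule ract_linear ract1 ractM ract_morph.

End Restriction.

Definition module_morphism (k : closedFieldType) (N : algMonoid k)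
    (V W : ratModule N) (xi : V -> W) : Prop :=
  linear xi /\ forall v x, xi (rm_act v x) = rm_act (xi v) x.

(* Main.v *)
From HB Require Import structures.
Require Import Defs.
From mathcomp Require Import all_boot all_algebra.
From mathcomp Require Import mpoly.
From mathcomp Require classical_sets.
From Stdlib Require Import Classical FunctionalExtensionality.

Set Implicit Arguments.
Unset Strict Implicit.
Unset Printing Implicit Defensive.

Import GRing.Theory passmx.
Local Open Scope ring_scope.

(* If H is observable and f is semi-invariant of weight rho, an invariant f g in
   the ideal of f gives a g of weight rho^-1.  Conversely, let Z be a finite
   dimensional H-stable space of functions on M.  The functions
   m |-> det (z_i (m m_j)) show that det Z is extendible, and expanding such a
   determinant along a column z_i (m) with z_i in an H-stable ideal, then
   multiplying by a semi-invariant of weight (det Z)^-1, yields an invariant in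
   that ideal.

   To embed an H-module V, view it inside k[H]^n and write it as Z/Y with Z made
   of functions on M and Y those vanishing on H.  For a basis y_1, ..., y_d of Y
   and s of weight (det Y)^-1, the functions
   m |-> s(m) det (z, y_1, ..., y_d at m m_0, ..., m m_d)
   depend H-equivariantly on the class of z in Z/Y and separate Z/Y; their
   translates under M span a finite dimensional M-module.

   Finite dimensionality of spans of translates is expressed by the finite rank
   of the kernel (x, w) |-> f(x w), and bases are extracted from a nonzero minor
   of maximal size.  The Nullstellensatz shows that inverses of characters of H
   are regular and that the regular functions on G are the f / det^n. *)

(** * The Nullstellensatz *)

Section Ideals.
Context (A : comNzRingType).
Implicit Types (I P : A -> Prop).

Record ring_ideal I : Prop := RingIdeal {
  ri0 : I 0;
  riD : forall x y, I x -> I y -> I (x + y);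
  riM : forall a x, I x -> I (a * x) }.

Record prime_ideal P : Prop := PrimeIdeal {
  pi_ideal :> ring_ideal P;
  pi_proper : ~ P 1;
  pi_prime : forall x y, P (x * y) -> P x \/ P y }.

Lemma riN I x : ring_ideal I -> I x -> I (- x).
Proof. by move=> hI Ix; rewrite -mulN1r; apply: riM. Qed.

Lemma riB I x y : ring_ideal I -> I x -> I y -> I (x - y).
Proof. by move=> hI Ix Iy; apply: riD => //; apply: riN. Qed.

Lemma ri_sum I (J : Type) (r : seq J) (Q : pred J) (F : J -> A) :
  ring_ideal I -> (forall j, Q j -> I (F j)) -> I (\sum_(j <- r | Q j) F j).
Proof. by move=> hI h; elim/big_ind: _ => //; [apply: ri0|apply: riD]. Qed.

Lemma pi_primeX P x n : prime_ideal P -> P (x ^+ n) -> P x.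
Proof.
move=> hP; elim: n => [|n IHn]; first by move/(pi_proper hP).
by rewrite exprS => /(pi_prime hP)[].
Qed.

(** Krull's argument: an ideal maximal among those containing [I] and missing the powers of [s] is
    prime. If x and y lie outside it, adjoining either one captures a power of [s], and the product
    of these powers lies in the ideal enlarged by x y only. *)
Lemma prime_avoiding_powers I s :
    ring_ideal I -> (forall n, ~ I (s ^+ n)) ->
  exists P, [/\ prime_ideal P, forall x, I x -> P x & ~ P s].
Proof.
move=> hI sI.
pose avoids (J : A -> Prop) :=
  [/\ ring_ideal J, forall x, I x -> J x & forall n, ~ J (s ^+ n)].
pose T (J : A -> Prop) := (forall x, ~ J x) \/ avoids J.
have [|J [TJ maxJ]] := @classical_sets.Zorn_bigcup A T.
  move=> F FT totF.
  have [[J0 [FJ0 [x0 J0x0]]]|noJ] :=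
    classic (exists J, F J /\ exists x, J x); last first.
    by left=> x [J FJ Jx]; apply: noJ; exists J; split=> //; exists x.
  have av J x : F J -> J x -> avoids J.
    by move=> FJ Jx; case: (FT J FJ) => // /(_ x).
  right; have [hJ0 IJ0 _] := av _ _ FJ0 J0x0.
  split=> [|x Ix|n [J FJ Js]]; last by have [_ _ /(_ n)] := av _ _ FJ Js.
  - split=> [|x y [J FJ Jx] [K FK Ky]|a x [J FJ Jx]].
    + by exists J0 => //; apply: ri0.
    + have [hJ _ _] := av _ _ FJ Jx; have [hK _ _] := av _ _ FK Ky.
      by case: (totF J K FJ FK) => sub; [exists K|exists J] => //;
        apply: riD => //; apply: sub.
    + by have [hJ _ _] := av _ _ FJ Jx; exists J => //; apply: riM.
  - by exists J0 => //; apply: IJ0.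
have {TJ} [hJ IJ sJ] : avoids J.
  case: TJ => // J0; case: (maxJ I); last by right; split.
  split; first by move=> x /J0.
  by move=> /(_ 0 (ri0 hI)) /J0.
have adjoin x : ~ J x -> exists n u v, J u /\ s ^+ n = u + v * x.
  move=> Jx; pose K y := exists u v, J u /\ y = u + v * x.
  apply: NNPP => noK; case: (maxJ K).
    split=> [y Jy|sub]; first by exists y, 0; rewrite mul0r addr0.
    by apply: Jx; apply: sub; exists 0, 1; rewrite mul1r add0r; split=> //;
      apply: ri0.
  right; split.
  - split=> [|y z [u [v [Ju ->]]] [u' [v' [Ju' ->]]]|a y [u [v [Ju ->]]]].
    + by exists 0, 0; rewrite mul0r addr0; split=> //; apply: ri0.
    + by exists (u + u'), (v + v'); split; [apply: riD|rewrite mulrDl addrACA].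
    + by exists (a * u), (a * v); split; [apply: riM|rewrite mulrDr mulrA].
  - by move=> y Iy; exists y, 0; rewrite mul0r addr0; split=> //; apply: IJ.
  - by move=> n [u [v h]]; apply: noK; exists n, u, v.
exists J; split=> //; last by move=> Js; apply: (sJ 1); rewrite expr1.
split=> // [J1|x y Jxy]; first by apply: (sJ 0); rewrite expr0.
have [|Jx] := classic (J x); first by left.
have [|Jy] := classic (J y); first by right.
have [a [u [v [Ju eu]]]] := adjoin _ Jx; have [b [u' [v' [Ju' eu']]]] := adjoin _ Jy.
case: (sJ (a + b)%N); rewrite exprD eu eu' mulrDr (mulrDl u _ (v' * y)) mulrACA.
apply: riD => //; first exact: riM.
by apply: riD => //; [rewrite mulrC|]; apply: riM.
Qed.

End Ideals.

Lemma exists_min (T : Type) (Q : T -> Prop) (mu : T -> nat) x :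
  Q x -> exists2 y, Q y & forall z, Q z -> (mu y <= mu z)%N.
Proof.
have [n] := ubnP (mu x); elim: n x => // n IHn x lexn Qx.
have [[z [Qz ltzx]]|h] := classic (exists z, Q z /\ (mu z < mu x)%N).
  by apply: (IHn z) => //; apply: leq_trans ltzx _.
by exists x => // z Qz; rewrite leqNgt; apply/negP => lt; apply: h; exists z.
Qed.

Section PolynomialStep.
Context (k : closedFieldType) (A : idomainType) (P : {poly A} -> Prop).
Context (hP : prime_ideal P).

(** Membership in (P cap A)[X], the ideal generated by the constants of [P]. *)
Let coefs_in (f : {poly A}) := forall i, P (f`_i)%:P.

Let coefs_inP f : coefs_in f -> P f.
Proof.
move=> h; rewrite -[f]coefK poly_def; apply: (ri_sum _ hP) => i _.
by rewrite -mul_polyC mulrC; apply: (riM hP).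
Qed.

(** Otherwise subtracting the leading term would give a shorter element of [J], still outside (P cap
    A)[X]. *)
Let lead_notin (J : {poly A} -> Prop) t :
    (forall f, P f -> J f) -> (forall f g, J f -> P g -> J (f - g)) ->
    J t -> ~ coefs_in t ->
    (forall f, J f -> ~ coefs_in f -> (size t <= size f)%N) ->
  ~ P (lead_coef t)%:P.
Proof.
move=> PJ JB Jt Nt min Pl.
have t0 : t != 0.
  by apply: contra_notN Nt => /eqP -> i; rewrite coef0; apply: (ri0 hP).
set u := (lead_coef t)%:P * 'X^((size t).-1).
have Pu : coefs_in u.
  move=> i; rewrite coefCM coefXn; case: eqP => _; rewrite ?mulr1 // mulr0.
  exact: (ri0 hP).
have : (size t <= size (t - u)%R)%N.
  apply: min; first by apply: JB => //; apply: coefs_inP.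
  move=> h; apply: Nt => i; rewrite -[t](subrK u) coefD polyCD.
  by apply: (riD hP).
apply/negP; rewrite -ltnNge.
have := size_poly_gt0 t; rewrite t0 => st0.
rewrite -(prednK st0) ltnS; apply/leq_sizeP => j.
rewrite leq_eqVlt => /orP[/eqP <-|ltj]; rewrite coefB coefCM coefXn.
  by rewrite eqxx mulr1 subrr.
by rewrite gtn_eqF // mulr0 subr0 nth_default // -(prednK st0).
Qed.

Let pi_scale c f n : ~ P c%:P -> P (c ^+ n *: f) -> P f.
Proof.
move=> Pc; rewrite -mul_polyC => /(pi_prime hP)[] //; rewrite rmorphXn /=.
by move/(pi_primeX hP).
Qed.

(* Unless P is generated by P cap A, take g in P of least degree outside
   (P cap A)[X].  By primality of P, the ideal generated by P and s contains a
   constant c0 outside P, and c = c0 * lead_coef g works: x is any root of the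
   image of g. *)
Lemma prime_point_step (s : {poly A}) : ~ P s ->
  exists2 c, ~ P c%:P & forall phi : {rmorphism A -> k},
    (forall a, P a%:P -> phi a = 0) -> phi c != 0 ->
    exists x, (forall f, P f -> (map_poly phi f).[x] = 0) /\
              (map_poly phi s).[x] != 0.
Proof.
move=> Ps.
have phi0 (phi : {rmorphism A -> k}) f :
    (forall a, P a%:P -> phi a = 0) -> coefs_in f -> map_poly phi f = 0.
  by move=> h hf; apply/polyP => i; rewrite coef_map coef0; apply: h.
(* If P = (P cap A)[X], some coefficient of [s] lies outside [P]; when [phi] does not kill it, the
   image of [s] is nonzero and has a nonroot. *)
have [allc|] := classic (forall f, P f -> coefs_in f).
  have [i Pi] : exists i, ~ P (s`_i)%:P.
    by apply: NNPP => h; apply: Ps; apply: coefs_inP => i; apply: NNPP => Pi;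
      apply: h; exists i.
  exists s`_i => // phi hphi phii.
  have /closed_nonrootP[x sx] : map_poly phi s != 0.
    by apply: contraNneq phii => /polyP/(_ i); rewrite coef_map coef0 => ->.
  by exists x; split=> // f /allc/phi0 -> //; rewrite horner0.
move=> /not_all_ex_not[g0 Ng0'].
have [Pg0 Ng0] := imply_to_and _ _ Ng0'.
have [g [Pg Ng] ming] := @exists_min _ (fun f => P f /\ ~ coefs_in f)
  (fun f => size f) _ (conj Pg0 Ng0).
have lg : ~ P (lead_coef g)%:P.
  by apply: (lead_notin (J := P)) => //; [move=> *; apply: (riB hP)|
    move=> f Pf Nf; apply: ming].
(* [J] is the ideal generated by [P] and [s]. Its shortest element t outside (P cap A)[X] will turn
   out to be the constant c0; by minimality, pseudo-remainders modulo t of elements of [J] lie in (P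
   cap A)[X]. *)
pose J f := exists u, P (f - u * s).
have PJ f : P f -> J f by move=> Pf; exists 0; rewrite mul0r subr0.
have JM a f : J f -> J (a * f).
  by move=> [u h]; exists (a * u); rewrite -mulrA -mulrBr; apply: (riM hP).
have JB f f' : J f -> J f' -> J (f - f').
  move=> [u h] [u' h']; exists (u - u').
  have -> : f - f' - (u - u') * s = (f - u * s) - (f' - u' * s).
    by rewrite mulrBl !opprD !opprK addrACA.
  exact: (riB hP).
have Js : J s by exists 1; rewrite mul1r subrr; apply: (ri0 hP).
have [t [Jt Nt] mint] := @exists_min _ (fun f => J f /\ ~ coefs_in f)
  (fun f => size f) _ (conj (PJ _ Pg) Ng).
have lt : ~ P (lead_coef t)%:P.
  by apply: (lead_notin (J := J)) => //; [move=> f f' Jf /PJ; apply: JB|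
    move=> f Jf Nf; apply: mint].
have nz f : ~ coefs_in f -> f != 0.
  by move=> Nf; apply: contra_notN Nf => /eqP -> i; rewrite coef0; apply: (ri0 hP).
have remJ f : J f -> coefs_in (f %% t)%R.
  move=> Jf; apply: NNPP => Nr.
  have /mint : J (f %% t)%R /\ ~ coefs_in (f %% t)%R.
    split=> //; have -> : (f %% t)%R =
        (lead_coef t ^+ scalp f t)%:P * f - (f %/ t)%R * t.
      by rewrite mul_polyC Pdiv.Idomain.divp_eq addrC addKr.
    by apply: JB; apply: JM.
  by apply/negP; rewrite -ltnNge Pdiv.Idomain.ltn_modpN0 // nz.
have divE f := Pdiv.Idomain.divp_eq f t.
have Pt : ~ P t.
  move=> Pt; apply: Ps; apply: (pi_scale (n := scalp s t) lt); rewrite divE.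
  by apply: (riD hP); [apply: (riM hP)|apply: coefs_inP; apply: remJ].
(* Up to a remainder in [P], the product of the quotient and t is a multiple of g; t is outside the
   prime [P], so the quotient is in [P]. *)
have Pq : P (g %/ t)%R.
  have [] // : P (g %/ t)%R \/ P t.
    apply: (pi_prime hP); rewrite -[X in P X](addrK (g %% t)%R) -divE -mul_polyC.
    by apply: (riB hP); [apply: (riM hP)|apply/coefs_inP/remJ/PJ].
have Nq : ~ coefs_in (g %/ t)%R.
  move=> hq; apply: lg; apply: (pi_primeX (n := 1)) => //; rewrite expr1.
  have hqt : coefs_in (lead_coef t ^+ scalp g t *: g)%R.
    rewrite divE => i; rewrite coefD polyCD; apply: (riD hP); last exact/remJ/PJ.
    rewrite coefM rmorph_sum; apply: (ri_sum _ hP) => j _.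
    by rewrite rmorphM /= mulrC; apply: (riM hP).
  have := hqt (size g).-1; rewrite coefZ -lead_coefE rmorphM rmorphXn /=.
  by case/(pi_prime hP) => // /(pi_primeX hP).
(* By minimality of g the quotient is no shorter than g, whereas its product with t is no longer
   than g; so t has degree 0. *)
have st1 : size t = 1.
  have t0 := nz _ Nt; have q0 := nz _ Nq.
  have leqt : (size ((g %/ t)%R * t)%R <= size g)%N.
    have -> : ((g %/ t) * t)%R = lead_coef t ^+ scalp g t *: g - (g %% t)%R.
      by rewrite divE addrK.
    apply: leq_trans (size_polyD _ _) _; rewrite geq_max size_polyN.
    rewrite size_scale_leq /=; apply: leq_trans (ltnW _) (mint _ _); last by split=> //; apply: PJ.
    exact: Pdiv.Idomain.ltn_modpN0.
  have leq := ming _ (conj Pq Nq).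
  have := leq_trans leqt leq; rewrite size_mul //.
  have : (0 < size t)%N by rewrite size_poly_gt0.
  case: (size t) => [|[|n]] // _; rewrite !addnS /= => h.
  by have := leq_trans h (leq_addr n _); rewrite ltnn.
have [u Pu] := Jt; have /eqP/size_poly1P[c0 c00 tE] := st1.
have lc0 : ~ P c0%:P by rewrite -tE.
exists (c0 * lead_coef g); first by rewrite rmorphM => /(pi_prime hP)[].
move=> phi hphi; rewrite rmorphM mulf_eq0 negb_or => /andP[phic0 phil].
(* The leading coefficient of g survives [phi], so g keeps its degree, which is positive because a
   constant of [P] lies in (P cap A)[X]. *)
have sg : size (map_poly phi g) = size g by rewrite size_map_poly_id0.
have /closed_rootP[x /rootP gx] : size (map_poly phi g) != 1.
  rewrite sg; apply: contra_notN Ng => /eqP/eqP/size_poly1P[c _ gE] i.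
  by move: Pg; rewrite gE coefC; case: eqP => // _ _; apply: (ri0 hP).
have Px f : P f -> (map_poly phi f).[x] = 0.
  move=> Pf.
  have /(phi0 phi _ hphi) r0 : coefs_in (f %% g)%R.
    apply: NNPP => Nr; have /ming : P (f %% g)%R /\ ~ coefs_in (f %% g)%R.
      split=> //; have -> : (f %% g)%R =
          (lead_coef g ^+ scalp f g)%:P * f - (f %/ g)%R * g.
        by rewrite mul_polyC Pdiv.Idomain.divp_eq addrC addKr.
      by apply: (riB hP); apply: (riM hP).
    by apply/negP; rewrite -ltnNge Pdiv.Idomain.ltn_modpN0 // nz.
  have := congr1 (fun h => (map_poly phi h).[x]) (Pdiv.Idomain.divp_eq f g).
  rewrite rmorphD rmorphM /= r0 addr0 hornerM gx mulr0 -mul_polyC rmorphM /=.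
  rewrite map_polyC hornerM hornerC /= => /eqP; rewrite mulf_eq0 rmorphXn /=.
  by rewrite expf_eq0 (negbTE phil) andbF => /eqP.
(* Since c0 - u s is in [P], a zero of [s] at x would force phi c0 = 0. *)
exists x; split=> //; apply: contraNneq phic0 => sx.
have := Px _ Pu; rewrite rmorphB rmorphM /= hornerD hornerN hornerM sx mulr0 subr0.
by rewrite tE map_polyC hornerC => ->.
Qed.

End PolynomialStep.

Lemma prime_ideal_preim (A B : comNzRingType) (f : {rmorphism A -> B}) P :
  prime_ideal P -> prime_ideal (fun a => P (f a)).
Proof.
move=> hP; split; [split|by rewrite rmorph1; apply: pi_proper|].
- by rewrite rmorph0; apply: (ri0 hP).
- by move=> x y; rewrite rmorphD; apply: (riD hP).
- by move=> x y; rewrite rmorphM; apply: (riM hP).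
- by move=> x y; rewrite rmorphM; apply: (pi_prime hP).
Qed.

(** * Splitting off the last variable of a polynomial ring *)

Section MpolySplit.
Context (R : idomainType) (n : nat).
Local Notation widen := (widen_ord (leqnSn n)).

(** The identification of R[x_1, ..., x_n][X] with R[x_1, ..., x_(n+1)], X becoming the last
    variable. *)
Definition mpoly_join : {poly {mpoly R[n]}} -> {mpoly R[n.+1]} :=
  horner_eval 'X_ord_max \o map_poly (@mwiden n R).

HB.instance Definition _ := GRing.RMorphism.on mpoly_join.

Lemma meval_widen (v : 'I_n.+1 -> R) q :
  (mwiden q).@[v] = q.@[v \o widen].
Proof.
rewrite /mwiden /mmap rmorph_sum mevalE; apply: eq_bigr => m _ /=.
rewrite mevalM mevalC /mmap1 rmorph_prod; congr (_ * _).
by apply: eq_bigr => i _; rewrite rmorphXn /= mevalXU.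
Qed.

Lemma meval_join (v : 'I_n.+1 -> R) p :
  (mpoly_join p).@[v] = (map_poly (meval (v \o widen)) p).[v ord_max].
Proof.
rewrite /mpoly_join /= /horner_eval -horner_map /= mevalXU -map_poly_comp.
by congr (_.[_]); apply: eq_map_poly => q /=; apply: meval_widen.
Qed.

Lemma mpoly_join_surj q : exists p, mpoly_join p = q.
Proof.
rewrite [q]mpolyE; elim/big_ind: _ => [|_ _ [p <-] [p' <-]|m _].
- by exists 0; rewrite rmorph0.
- by exists (p + p'); rewrite rmorphD.
have [p <-] : exists p, mpoly_join p = 'X_[m].
  rewrite mpolyXE_id; elim/big_ind: _ => [|_ _ [p <-] [p' <-]|i _].
  - by exists 1; rewrite rmorph1.
  - by exists (p * p'); rewrite rmorphM.
  have [p <-] : exists p, mpoly_join p = 'X_i; last by exists (p ^+ m i); rewrite rmorphXn.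
  have [lti|gei] := ltnP i n.
    exists ('X_(Ordinal lti))%:P.
    rewrite /mpoly_join /= /horner_eval map_polyC hornerC /= mwidenX mnmwiden1.
    by congr 'X_ _; apply: val_inj.
  exists 'X; rewrite /mpoly_join /= /horner_eval map_polyX hornerX.
  by congr 'X_ _; apply: val_inj; apply/eqP; rewrite eqn_leq /= gei -ltnS ltn_ord.
exists ((q@_m)%:MP%:P * p); rewrite rmorphM /=.
by rewrite /mpoly_join /= /horner_eval map_polyC hornerC /= mwidenC mul_mpolyC.
Qed.
End MpolySplit.

Section Nullstellensatz.
Context (k : closedFieldType).

(** Induction on the number of variables: [prime_point_step] trades [s] for an element c outside the
    contraction of [P] to one variable fewer, and a zero of the contraction where c does not vanish
    lifts. *)
Lemma prime_nullstellensatz n (P : {mpoly k[n]} -> Prop) s :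
    prime_ideal P -> ~ P s ->
  exists v : 'I_n -> k, (forall p, P p -> p.@[v] = 0) /\ s.@[v] != 0.
Proof.
elim: n P s => [|n IHn] P s hP Ps.
  have const q : q = (q.@[fun=> 0])%:MP_[0].
    by rewrite {1}[q]mpolyE mevalE rmorph_sum; apply: eq_bigr => m _ /=;
      rewrite big_ord0 mulr1 -mul_mpolyC (_ : m = 0%MM) ?mpolyX0 ?mulr1 //;
      apply/mnmP => -[].
  exists (fun=> 0); split=> [p Pp|].
    apply/eqP/negP => /negP p0; apply: (pi_proper hP).
    rewrite -[1]/(1%:MP_[0]) -(mulVf p0) mpolyCM -const; exact: (riM hP).
  apply: contra_notN Ps => /eqP s0; rewrite [s]const s0 mpolyC0; exact: (ri0 hP).
have [s' es] := mpoly_join_surj s.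
have hP' : prime_ideal (fun p : {poly {mpoly k[n]}} => P (mpoly_join p)).
  exact: (@prime_ideal_preim {poly {mpoly k[n]}} {mpoly k[n.+1]} (mpoly_join (n := n)) P hP).
have Ps' : ~ P (mpoly_join s') by rewrite es.
have [c Pc hc] := prime_point_step k hP' Ps'.
have hC := prime_ideal_preim (@polyC {mpoly k[n]}) hP'.
have [v [vP vc]] := IHn _ _ hC Pc.
have [x [xP xs]] := hc (meval v) vP vc.
pose w (i : 'I_n.+1) := if unlift ord_max i is Some j then v j else x.
have wl : w \o widen_ord (leqnSn n) =1 v.
  move=> i; rewrite /w /=.
  have -> : widen_ord (leqnSn n) i = lift ord_max i.
    by apply: val_inj; rewrite /= /bump leqNgt ltn_ord.
  by rewrite liftK.
have we p : (mpoly_join p).@[w] = (map_poly (meval v) p).[x].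
  rewrite meval_join /w unlift_none; congr (_.[_]).
  by apply: eq_map_poly => q; apply: meval_eq.
exists w; split=> [p|]; last by rewrite -es we.
by have [p' <-] := mpoly_join_surj p; rewrite we; apply: xP.
Qed.

Theorem nullstellensatz n (I : {mpoly k[n]} -> Prop) s :
    ring_ideal I ->
    (forall v : 'I_n -> k, (forall p, I p -> p.@[v] = 0) -> s.@[v] = 0) ->
  exists N, I (s ^+ N).
Proof.
move=> hI h; apply: NNPP => noN.
have [|P [hP IP Ps]] := @prime_avoiding_powers _ I s hI.
  by move=> N IN; apply: noN; exists N.
have [v [Pv]] := prime_nullstellensatz hP Ps.
by rewrite h ?eqxx // => p /IP/Pv.
Qed.

End Nullstellensatz.

(** * Kernels of finite rank *)

Section FiniteRank.
Context (k : fieldType).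

(** Equivalently, the functions [F a] span a finite dimensional space; in this form the closure
    properties require no choice of basis. *)
Definition finrank (A W : Type) (F : A -> W -> k) : Prop :=
  exists (J : finType) (c : A -> J -> k) (h : J -> W -> k),
    forall a w, F a w = \sum_j c a j * h j w.

Section Closure.
Context (A W : Type).
Implicit Types F G : A -> W -> k.

Lemma eq_finrank F G : (forall a w, F a w = G a w) -> finrank F -> finrank G.
Proof. by move=> e [J [c [h eF]]]; exists J, c, h => a w; rewrite -e. Qed.

Lemma finrank_left (u : A -> k) : finrank (fun a (_ : W) => u a).
Proof.
by exists 'I_1, (fun a _ => u a), (fun _ _ => 1) => a w; rewrite big_ord1 mulr1.
Qed.

Lemma finrank_right (u : W -> k) : finrank (fun (_ : A) w => u w).
Proof.
by exists 'I_1, (fun _ _ => 1), (fun _ w => u w) => a w; rewrite big_ord1 mul1r.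
Qed.

Lemma finrankD F G : finrank F -> finrank G -> finrank (fun a w => F a w + G a w).
Proof.
move=> [J [c [h eF]]] [J' [c' [h' eG]]].
exists (J + J')%type, (fun a s => match s with inl j => c a j | inr j => c' a j end),
  (fun s w => match s with inl j => h j w | inr j => h' j w end) => a w.
by rewrite big_sumType /= eF eG.
Qed.

Lemma finrankM F G : finrank F -> finrank G -> finrank (fun a w => F a w * G a w).
Proof.
move=> [J [c [h eF]]] [J' [c' [h' eG]]].
exists (J * J')%type, (fun a s => c a s.1 * c' a s.2), (fun s w => h s.1 w * h' s.2 w).
move=> a w; rewrite eF eG big_distrlr pair_big /=.
by apply: eq_bigr => s _; rewrite mulrACA.
Qed.

Lemma finrank_sum I (r : seq I) (Q : pred I) (F : I -> A -> W -> k) :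
  (forall i, finrank (F i)) -> finrank (fun a w => \sum_(i <- r | Q i) F i a w).
Proof.
move=> h; elim: r => [|i r IHr].
  by apply: eq_finrank (finrank_left (fun=> 0)) => a w; rewrite big_nil.
case Qi: (Q i); last by apply: eq_finrank IHr => a w; rewrite big_cons Qi.
by apply: eq_finrank (finrankD (h i) IHr) => a w; rewrite big_cons Qi.
Qed.

Lemma finrank_prod I (r : seq I) (Q : pred I) (F : I -> A -> W -> k) :
  (forall i, finrank (F i)) -> finrank (fun a w => \prod_(i <- r | Q i) F i a w).
Proof.
move=> h; elim: r => [|i r IHr].
  by apply: eq_finrank (finrank_left (fun=> 1)) => a w; rewrite big_nil.
case Qi: (Q i); last by apply: eq_finrank IHr => a w; rewrite big_cons Qi.
by apply: eq_finrank (finrankM (h i) IHr) => a w; rewrite big_cons Qi.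
Qed.

Lemma finrankX F n : finrank F -> finrank (fun a w => F a w ^+ n).
Proof.
move=> hF; have := @finrank_prod _ (iota 0 n) xpredT (fun=> F) (fun=> hF).
by apply: eq_finrank => a w; rewrite big_const_seq count_predT size_iota iter_mulr_1.
Qed.

Lemma finrank_meval n (p : {mpoly k[n]}) (v : A -> W -> 'I_n -> k) :
  (forall i, finrank (fun a w => v a w i)) -> finrank (fun a w => p.@[v a w]).
Proof.
move=> hv; apply: (@eq_finrank (fun a w =>
  \sum_(m <- msupp p) p@_m * \prod_i v a w i ^+ m i)) => [a w|].
  by rewrite mevalE.
apply: finrank_sum => m; apply: finrankM; first exact: finrank_left.
by apply: finrank_prod => i; apply: finrankX.
Qed.

Lemma finrank_det n (F : A -> W -> 'M[k]_n) :
  (forall i j, finrank (fun a w => F a w i j)) -> finrank (fun a w => \det (F a w)).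
Proof.
move=> hF; apply: finrank_sum => s; apply: finrankM; first exact: finrank_left.
by apply: finrank_prod => i; apply: hF.
Qed.

Lemma finrank_const_mulmx m n p (B : 'M[k]_(m, n)) (F : A -> W -> 'M[k]_(n, p)) i j :
  (forall l, finrank (fun a w => F a w l j)) -> finrank (fun a w => (B *m F a w) i j).
Proof.
move=> hF; apply: (@eq_finrank (fun a w => \sum_l B i l * F a w l j)) => [a w|].
  by rewrite mxE.
by apply: finrank_sum => l; apply: finrankM => //; apply: finrank_left.
Qed.

End Closure.

Lemma finrank_comp (A W A' W' : Type) (F : A -> W -> k) (u : A' -> A) (v : W' -> W) :
  finrank F -> finrank (fun a w => F (u a) (v w)).
Proof.
by move=> [J [c [h e]]]; exists J, (fun a => c (u a)), (fun j w => h j (v w)) => a w.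
Qed.

Lemma finrank_family (A W : Type) n (F : 'I_n -> A -> W -> k) :
  (forall i, finrank (F i)) -> finrank (fun ia : 'I_n * A => F ia.1 ia.2).
Proof.
move=> hF.
have := finrank_sum (index_enum 'I_n) xpredT (fun i => finrankM
  (finrank_left W (fun ia : 'I_n * A => (i == ia.1)%:R))
  (finrank_comp snd id (hF i))).
apply: eq_finrank => -[i a] w /=; rewrite (bigD1 i) //= eqxx mul1r.
by rewrite big1 ?addr0 // => j /negbTE ->; rewrite mul0r.
Qed.

Lemma finrank_familyr (A W : Type) n (F : 'I_n -> A -> W -> k) :
  (forall i, finrank (F i)) -> finrank (fun a (iw : 'I_n * W) => F iw.1 a iw.2).
Proof.
move=> hF.
have := finrank_sum (index_enum 'I_n) xpredT (fun i => finrankM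
  (finrank_right A (fun iw : 'I_n * W => (i == iw.1)%:R))
  (finrank_comp id snd (hF i))).
apply: eq_finrank => a [i w] /=; rewrite (bigD1 i) //= eqxx mul1r.
by rewrite big1 ?addr0 // => j /negbTE ->; rewrite mul0r.
Qed.

(** A matrix of values of [F] factors through a space of dimension [#|J|], which bounds its rank. *)
Lemma finrank_minors (A W : Type) (F : A -> W -> k) : finrank F ->
  exists r, forall m (al : 'I_m -> A) (be : 'I_m -> W),
    (\matrix_(i, j) F (al i) (be j)) \in unitmx -> (m <= r)%N.
Proof.
move=> [J [c [h eF]]]; exists #|J| => m al be u.
have e : (\matrix_(i, j) F (al i) (be j)) =
    (\matrix_(i < m, j < #|J|) c (al i) (enum_val j)) *m
    (\matrix_(i < #|J|, j < m) h (enum_val i) (be j)).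
  apply/matrixP => i j; rewrite !mxE eF (reindex _ (onW_bij _ (@enum_val_bij J))) /=.
  by apply: eq_bigr => l _; rewrite !mxE.
rewrite -(mxrank_unit u) e; apply: leq_trans (mxrankM_maxl _ _) (rank_leq_col _).
Qed.

(* A nonvanishing minor of maximal size: bordering it gives singular matrices,
   whose Schur complements therefore vanish. *)
Lemma skeleton_decomposition (A W : Type) (F : A -> W -> k) : finrank F ->
  exists m (al : 'I_m -> A) (be : 'I_m -> W),
    let G := \matrix_(i, j) F (al i) (be j) in
    G \in unitmx /\ forall a w,
      F a w = ((\row_j F a (be j)) *m invmx G *m (\col_i F (al i) w)) 0 0.
Proof.
move=> /finrank_minors[r hr].
pose Q m := exists (al : 'I_m -> A) (be : 'I_m -> W),
  (\matrix_(i, j) F (al i) (be j)) \in unitmx.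
have Q0 : Q 0%N.
  have empty T : 'I_0 -> T by case.
  by exists (empty A), (empty W); rewrite unitmxE det_mx00 unitr1.
(* Minimizing [r - m] maximizes m, since r bounds the size of every nonzero minor. *)
have [m [al [be uG]] minm] := exists_min (fun m => r - m)%N Q0.
exists m, al, be => G; split=> // a w.
set c := \row_j _; set b := \col_i _.
pose al' (i : 'I_(m + 1)) := if split i is inl i' then al i' else a.
pose be' (i : 'I_(m + 1)) := if split i is inl i' then be i' else w.
have e : \matrix_(i, j) F (al' i) (be' j) =
    block_mx 1%:M 0 (c *m invmx G) 1%:M *m
    block_mx G b 0 ((F a w)%:M - c *m invmx G *m b).
  rewrite mulmx_block !mul1mx !mul0mx !addr0 mulmxKV // addrC subrK.
  apply/matrixP => i j; rewrite mxE /al' /be'.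
  case: (split_ordP i) => i' ->; case: (split_ordP j) => j' ->.
  - by rewrite block_mxEul mxE.
  - by rewrite block_mxEur mxE.
  - by rewrite block_mxEdl mxE.
  - by rewrite block_mxEdr mxE !ord1 eqxx.
have : \det (\matrix_(i, j) F (al' i) (be' j)) = 0.
  apply/eqP/negP => /negP d0.
  have um : (\matrix_(i, j) F (al' i) (be' j)) \in unitmx by rewrite unitmxE unitfE.
  have lem := hr _ _ _ um.
  have := minm (m + 1)%N (ex_intro _ al' (ex_intro _ be' um)).
  by apply/negP; rewrite -ltnNge addn1 ltn_sub2l // -addn1.
rewrite e det_mulmx det_lblock !det1 !mul1r det_ublock => /eqP.
rewrite mulf_eq0 -[_ == 0]negbK -unitfE -unitmxE uG /= det_mx11 => /eqP.
by rewrite !mxE mulr1n => /subr0_eq.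
Qed.

End FiniteRank.

(** * Regular functions and their translates *)

Section Regular.
Context (k : closedFieldType) (T : Type) (X : affine k T).

Lemma eq_regular (f g : T -> k) : (forall x, f x = g x) -> regular X f -> regular X g.
Proof. by move=> e [p hp]; exists p => x; rewrite -e. Qed.

Lemma regular_const c : regular X (fun=> c).
Proof. by exists c%:MP => x; rewrite mevalC. Qed.

Lemma regular_coord i : regular X (fun x => aemb X x 0 i).
Proof. by exists 'X_i => x; rewrite mevalXU. Qed.

Lemma regularD f g : regular X f -> regular X g -> regular X (fun x => f x + g x).
Proof. by move=> [p hp] [q hq]; exists (p + q) => x; rewrite mevalD hp hq. Qed.

Lemma regularM f g : regular X f -> regular X g -> regular X (fun x => f x * g x).
Proof. by move=> [p hp] [q hq]; exists (p * q) => x; rewrite mevalM hp hq. Qed.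

Lemma regularB f g : regular X f -> regular X g -> regular X (fun x => f x - g x).
Proof. by move=> [p hp] [q hq]; exists (p - q) => x; rewrite mevalB hp hq. Qed.

Lemma regularX f n : regular X f -> regular X (fun x => f x ^+ n).
Proof. by move=> [p hp]; exists (p ^+ n) => x; rewrite rmorphXn hp. Qed.

Lemma regular_sum I (r : seq I) (Q : pred I) (F : I -> T -> k) :
  (forall i, regular X (F i)) -> regular X (fun x => \sum_(i <- r | Q i) F i x).
Proof.
move=> h; elim: r => [|i r IHr].
  by apply: eq_regular (regular_const 0) => x; rewrite big_nil.
case Qi: (Q i); last by apply: eq_regular IHr => x; rewrite big_cons Qi.
by apply: eq_regular (regularD (h i) IHr) => x; rewrite big_cons Qi.
Qed.

Lemma regular_prod I (r : seq I) (Q : pred I) (F : I -> T -> k) :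
  (forall i, regular X (F i)) -> regular X (fun x => \prod_(i <- r | Q i) F i x).
Proof.
move=> h; elim: r => [|i r IHr].
  by apply: eq_regular (regular_const 1) => x; rewrite big_nil.
case Qi: (Q i); last by apply: eq_regular IHr => x; rewrite big_cons Qi.
by apply: eq_regular (regularM (h i) IHr) => x; rewrite big_cons Qi.
Qed.

Lemma regular_meval n (p : {mpoly k[n]}) (v : T -> 'I_n -> k) :
  (forall i, regular X (fun x => v x i)) -> regular X (fun x => p.@[v x]).
Proof.
move=> hv; apply: (@eq_regular (fun x =>
  \sum_(m <- msupp p) p@_m * \prod_i v x i ^+ m i)) => [x|].
  by rewrite mevalE.
apply: regular_sum => m; apply: regularM; first exact: regular_const.
by apply: regular_prod => i; apply: regularX.
Qed.

Definition regular_mx m n (F : T -> 'M[k]_(m, n)) :=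
  forall i j, regular X (fun x => F x i j).

Lemma regular_mx_const m n (A : 'M[k]_(m, n)) : regular_mx (fun=> A).
Proof. by move=> i j; apply: regular_const. Qed.

Lemma regular_mulmx m n p (F : T -> 'M[k]_(m, n)) (G : T -> 'M[k]_(n, p)) :
  regular_mx F -> regular_mx G -> regular_mx (fun x => F x *m G x).
Proof.
move=> hF hG i j; apply: eq_regular (fun x => esym (mxE _ _ _ _)) _.
by apply: regular_sum => l; apply: regularM.
Qed.

Lemma regular_det n (F : T -> 'M[k]_n) :
  regular_mx F -> regular X (fun x => \det (F x)).
Proof.
move=> hF; apply: regular_sum => s; apply: regularM; first exact: regular_const.
by apply: regular_prod => i; apply: hF.
Qed.

Lemma zclosed_zeros f : regular X f -> zclosed X (fun x => f x = 0).
Proof.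
move=> [p hp]; exists (fun q => q = p) => x; split=> [f0 q ->|]; rewrite ?hp -?hp //.
by move=> /(_ p erefl) <-.
Qed.

(** The zero sets of f and g can cover an irreducible variety only if one of them is everything. *)
Lemma regular_domain f g : zirreducible X -> regular X f -> regular X g ->
  (exists x, f x != 0) -> (exists x, g x != 0) -> exists x, f x * g x != 0.
Proof.
move=> [_ irr] /zclosed_zeros zf /zclosed_zeros zg [x fx] [y gy].
apply: NNPP => h; case: (irr _ _ zf zg) => [z|/(_ x) f0|/(_ y) g0].
- apply: NNPP => /not_or_and[/eqP fz /eqP gz]; apply: h.
  by exists z; rewrite mulf_neq0.
- by rewrite f0 eqxx in fx.
- by rewrite g0 eqxx in gy.
Qed.

End Regular.

Section AlgMonoid.
Context (k : closedFieldType) (M : algMonoid k).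

Lemma coord_mul (f : M -> k) : coord_ring f ->
  exists q : {mpoly k[adim (am_var M) + adim (am_var M)]}, forall x y : M,
    f (x * y)%M = q.@[row_mx (aemb (am_var M) x) (aemb (am_var M) y) 0].
Proof. by move=> /am_morph[q hq]; exists q => x y; rewrite (hq (x, y)). Qed.

Lemma coord_ring_lmul (f : M -> k) y : coord_ring f -> coord_ring (fun x => f (y * x)%M).
Proof.
move=> /coord_mul[q hq]; apply: eq_regular (fun x => esym (hq y x)) _.
apply: regular_meval => i; case: (split_ordP i) => j ->.
  by apply: eq_regular (regular_const _ _) => x; rewrite row_mxEl.
by apply: eq_regular (regular_coord j) => x; rewrite row_mxEr.
Qed.

Lemma coord_ring_rmul (f : M -> k) y : coord_ring f -> coord_ring (fun x => f (x * y)%M).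
Proof.
move=> /coord_mul[q hq]; apply: eq_regular (fun x => esym (hq x y)) _.
apply: regular_meval => i; case: (split_ordP i) => j ->.
  by apply: eq_regular (regular_coord j) => x; rewrite row_mxEl.
by apply: eq_regular (regular_const _ _) => x; rewrite row_mxEr.
Qed.

(** Local finiteness of translations: f (x y) is a polynomial in the coordinates of x and y, and
    each coordinate is a kernel depending on one variable only. *)
Lemma coord_ring_finrank (f : M -> k) :
  coord_ring f -> finrank (fun x y => f (x * y)%M).
Proof.
move=> /coord_mul[q hq]; apply: eq_finrank (fun x y => esym (hq x y)) _.
apply: finrank_meval => i; case: (split_ordP i) => j ->.
  apply: eq_finrank (finrank_left _ (fun x => aemb (am_var M) x 0 j)) => x y.
  by rewrite row_mxEl.
apply: eq_finrank (finrank_right _ (fun x => aemb (am_var M) x 0 j)) => x y.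
by rewrite row_mxEr.
Qed.

End AlgMonoid.

(** When there are as many points as components, invertibility certifies that the components of g
    are linearly independent. *)
Definition values (k : fieldType) (W : Type) m n (g : W -> 'cV[k]_m) (p : 'I_n -> W) :
    'M[k]_(m, n) :=
  \matrix_(i, j) g (p j) i 0.

Lemma values_mul (k : fieldType) (W : Type) m n l (b : 'M[k]_(l, m))
    (g : W -> 'cV[k]_m) (p : 'I_n -> W) :
  values (fun w => b *m g w) p = b *m values g p.
Proof.
by apply/matrixP => i j; rewrite !mxE; apply: eq_bigr => s _; rewrite !mxE.
Qed.

Lemma mulmx_values_inj (k : fieldType) (W : Type) m l (g : W -> 'cV[k]_m)
    (p : 'I_m -> W) (b c : 'M[k]_(l, m)) :
  values g p \in unitmx -> (forall w, b *m g w = c *m g w) -> b = c.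
Proof.
move=> u e; apply: (can_inj (mulmxK u)); rewrite -!values_mul.
by apply/matrixP => i j; rewrite mxE e [RHS]mxE.
Qed.

(** * Spans of translates and the matrix representations they carry *)

Section StableFamily.
Context (k : closedFieldType) (S : algMonoid k) (W : Type) (act : S -> W -> W).
Context (act1 : forall w, act 1%M w = w).
Context (actM : forall x y w, act (x * y)%M w = act x (act y w)).

(* [w |-> sb_fun w] lists a basis of the span of the translates of the f i. *)
Record stable_basis n (f : 'I_n -> W -> k) := StableBasis {
  sb_dim : nat;
  sb_fun : W -> 'cV[k]_sb_dim;
  sb_mx : S -> 'M[k]_sb_dim;
  sb_coef : 'M[k]_(n, sb_dim);
  sb_idx : 'I_sb_dim -> 'I_n;
  sb_shift : 'I_sb_dim -> S;
  sb_pt : 'I_sb_dim -> W;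
  sb_funE : forall w i, sb_fun w i 0 = f (sb_idx i) (act (sb_shift i) w);
  sb_unit : values sb_fun sb_pt \in unitmx;
  sb_act : forall x w, sb_fun (act x w) = sb_mx x *m sb_fun w;
  sb_coefE : forall w, \col_i f i w = sb_coef *m sb_fun w }.

(** The rows selected by [skeleton_decomposition] are translates forming a basis, and its formula
    expands every translate in them: translates of the basis give [sb_mx], the functions f i give
    [sb_coef]. *)
Lemma stable_basis_exists n (f : 'I_n -> W -> k) :
  finrank (fun ix w => f ix.1 (act ix.2 w)) -> inhabited (stable_basis f).
Proof.
move=> /skeleton_decomposition[m [al [p [uG dec]]]].
set G := \matrix_(i, j) _ in uG dec.
pose g w := \col_(i < m) f (al i).1 (act (al i).2 w).
have dec' i x w :
    f i (act x w) = ((\row_j f i (act x (p j))) *m invmx G *m g w) 0 0.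
  by rewrite (dec (i, x) w).
pose a x := (\matrix_(i, j) f (al i).1 (act ((al i).2 * x)%M (p j))) *m invmx G.
pose b := (\matrix_(i, j) f i (p j)) *m invmx G.
have rowE l (B : 'M[k]_(l, m)) (C : 'M_m) (c : 'cV_m) i :
    (B *m C *m c) i 0 = ((\row_j B i j) *m C *m c) 0 0.
  have -> : \row_j B i j = row i B by apply/rowP => j; rewrite !mxE.
  by rewrite -!row_mul [RHS]mxE.
constructor; apply: (@StableBasis _ _ m g a b (fun i => (al i).1)
  (fun i => (al i).2) p) => [w i||x w|w].
- by rewrite mxE.
- by rewrite (_ : values g p = G) //; apply/matrixP => i j; rewrite !mxE.
- apply/colP => i; rewrite [LHS]mxE -actM dec' [RHS]rowE.
  congr (fun_of_matrix (_ *m _ *m _) 0 0).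
  by apply/rowP => j; rewrite !mxE.
- apply/colP => i; rewrite [LHS]mxE -[w in LHS]act1 dec' [RHS]rowE.
  by congr (fun_of_matrix (_ *m _ *m _) 0 0); apply/rowP => j; rewrite !mxE act1.
Qed.

Context n (f : 'I_n -> W -> k) (B : stable_basis f).

Lemma sb_mxM x y : sb_mx B (x * y)%M = sb_mx B x *m sb_mx B y.
Proof.
by apply: mulmx_values_inj (sb_unit B) _ => w; rewrite -sb_act actM !sb_act mulmxA.
Qed.

Lemma sb_mx1 : sb_mx B 1%M = 1%:M.
Proof.
by apply: mulmx_values_inj (sb_unit B) _ => w; rewrite -sb_act act1 mul1mx.
Qed.

Lemma sb_fun_regular :
  (forall i w, coord_ring (fun x => f i (act x w))) ->
  forall w, regular_mx (am_var S) (fun x => sb_fun B (act x w)).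
Proof.
move=> hf w i j; rewrite ord1.
have h := coord_ring_lmul (sb_shift i) (hf (sb_idx i) w).
by apply: eq_regular h => x; rewrite sb_funE actM.
Qed.

(** Evaluating [sb_act] at the points [sb_pt] and inverting a constant matrix solves for [sb_mx]. *)
Lemma sb_mx_regular :
  (forall i w, coord_ring (fun x => f i (act x w))) ->
  regular_mx (am_var S) (sb_mx B).
Proof.
move=> hf i j.
have h : regular_mx (am_var S) (fun x =>
    values (fun w => sb_fun B (act x w)) (sb_pt (s := B)) *m
      invmx (values (sb_fun B) (sb_pt (s := B)))).
  apply: regular_mulmx; last exact: regular_mx_const.
  move=> i' j'; apply: eq_regular (sb_fun_regular hf (sb_pt j') i' 0) => x.
  by rewrite mxE.
apply: eq_regular (h i j) => x; congr (fun_of_matrix _ i j).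
rewrite (_ : values _ _ = sb_mx B x *m values (sb_fun B) (sb_pt (s := B))) ?mulmxK ?sb_unit //.
by rewrite -values_mul; apply/matrixP => i' j'; rewrite mxE sb_act [RHS]mxE.
Qed.

End StableFamily.

(** * Determinants *)

Lemma finrank_mulmx (k : fieldType) m n p (b : 'M[k]_(n, m)) (c : 'M[k]_(m, p)) i j :
  finrank (fun X Y : 'M[k]_m => (b *m (X *m Y) *m c) i j).
Proof.
exists 'I_m, (fun X l => (b *m X) i l), (fun l Y => (Y *m c) l j) => X Y.
by rewrite mulmxA -mulmxA mxE.
Qed.

(* If Q vanished at all A^n, n >= 0, but not at A^-1, the matrices
   (Q (A^i A^-(j+1)))_(i, j) would be triangular and invertible of any size. *)
Lemma vanish_at_inverse (k : fieldType) m (Q : 'M[k]_m -> k) (A : 'M[k]_m) :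
  finrank (fun X Y : 'M_m => Q (X *m Y)) -> A \in unitmx ->
  (forall n, Q (A ^+ n) = 0) -> Q (invmx A) = 0.
Proof.
move=> /finrank_minors[r hr] uA QA; apply/eqP/negP => /negP Q0.
have AV n : A ^+ n * invmx A ^+ n = 1.
  have AV : A * invmx A = 1 by apply: mulmxV.
  have VA : invmx A * A = 1 by apply: mulVmx.
  by rewrite -exprMn_comm ?AV ?expr1n // /GRing.comm AV VA.
have AA i j : (j < i)%N -> A ^+ i *m invmx A ^+ j.+1 = A ^+ (i - j.+1).
  move=> lt; rewrite -[LHS]/(A ^+ i * invmx A ^+ j.+1).
  by rewrite -{1}(subnK lt) exprD -mulrA AV mulr1.
pose G := \matrix_(i < r.+1, j < r.+1) Q (A ^+ i *m invmx A ^+ j.+1).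
have trG : is_trig_mx G^T.
  by apply/is_trig_mxP => i j lt; rewrite !mxE AA.
suff /hr : G \in unitmx by rewrite ltnn.
rewrite unitmxE -det_tr det_trig // unitfE; apply/prodf_neq0 => i _.
rewrite !mxE -[A ^+ i *m _]/(A ^+ i * invmx A ^+ i.+1) exprSr mulrA AV.
by rewrite mul1r.
Qed.

Section Determinant.
Context (k : closedFieldType) (M : algMonoid k).

Lemma am_unit_factors (d : M -> k) : d 1%M = 1 ->
  (forall x y, d (x * y)%M = d x * d y) -> forall x, am_unit x -> d x != 0.
Proof.
move=> d1 dM x [y [xy _]]; apply: contra_eqN d1 => /eqP dx.
by rewrite -xy dM dx mul0r eq_sym oner_neq0.
Qed.

(** M acts on the span of the translates of its coordinate functions by matrices [a x], from which x
    is recovered linearly; their determinant is the required morphism. If it is nonzero at x, the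
    inverse matrix comes from M, because by [vanish_at_inverse] it satisfies the polynomial
    equations satisfied by all powers of [a x]. *)
Lemma determinant_exists : exists d : M -> k, is_determinant d.
Proof.
pose f i (x : M) := aemb (am_var M) x 0 i.
have fr i : coord_ring (f i) by apply: regular_coord.
have [B] := stable_basis_exists (@am_mul1m k M) (fun x y w => esym (am_mulA x y w))
  (finrank_family (fun i => coord_ring_finrank (fr i))).
have aM := sb_mxM (fun x y w => esym (am_mulA x y w)) B.
have a1 := sb_mx1 (@am_mul1m k M) B.
have areg := sb_mx_regular (B := B) (fun x y w => esym (am_mulA x y w))
  (fun i w => coord_ring_rmul w (fr i)).
set a := sb_mx B in aM a1 areg.
pose emb (X : 'M[k]_(sb_dim B)) := (sb_coef B *m X *m sb_fun B 1%M)^T.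
have embE x : aemb (am_var M) x = emb (a x).
  rewrite /emb -mulmxA -sb_act am_mulm1 -sb_coefE.
  by apply/rowP => i; rewrite !mxE.
have emb_finrank i : finrank (fun X Y : 'M_(sb_dim B) => emb (X *m Y) 0 i).
  apply: eq_finrank (finrank_mulmx (sb_coef B) (sb_fun B 1%M) i 0) => X Y.
  by rewrite [RHS]mxE.
exists (fun x => \det (a x)); split.
- exact: regular_det.
- by rewrite a1 det1.
- by move=> x y; rewrite aM det_mulmx.
move=> x; split=> [d0 ux|nu].
  suff /eqP : \det (a x) != 0 by [].
  apply: (am_unit_factors (d := fun x => \det (a x))) ux; first by rewrite a1 det1.
  by move=> y z; rewrite aM det_mulmx.
apply/eqP/negP => /negP d0; apply: nu.
have uA : a x \in unitmx by rewrite unitmxE unitfE.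
have powE n : a x ^+ n = a (iter n (am_mul x) 1%M).
  by elim: n => [|n IHn]; rewrite ?a1 // exprS IHn /= aM.
have [C hC] := aemb_closed (am_var M).
have [y ey] : exists y, aemb (am_var M) y = emb (invmx (a x)).
  apply/hC => p Cp.
  apply: (vanish_at_inverse (Q := fun X => p.@[emb X 0])) => // [|n].
    by apply: finrank_meval => i.
  by rewrite powE -embE; apply: ((hC _).1 _ p Cp); eexists.
have ay : a y = invmx (a x).
  apply/matrixP => i j; have [p hp] := areg i j.
  apply/eqP; rewrite -subr_eq0 hp ey; apply/eqP.
  apply: (vanish_at_inverse (Q := fun X => p.@[emb X 0] - X i j)) => // [|n].
    apply: finrankD; first by apply: finrank_meval => l.
    apply: eq_finrank (finrank_mulmx (- 1%:M) 1%:M i j) => X Y.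
    by rewrite mulmx1 mulNmx mul1mx mxE.
  by rewrite powE -embE -hp subrr.
by exists y; split; apply: (@aemb_inj _ _ (am_var M)); rewrite !embE aM ay
  ?mulmxV ?mulVmx // a1.
Qed.

End Determinant.

(** * Regular functions on the unit group, characters *)

Section AffineNullstellensatz.
Context (k : closedFieldType) (T : Type) (X : affine k T).

(** The polynomials restricting to elements of [J] form an ideal containing the equations of [X], so
    its common zeros are points of [X]. *)
Lemma affine_nullstellensatz (J : (T -> k) -> Prop) (s : T -> k) :
    is_ideal (regular X) J -> regular X s ->
    (forall x, (forall f, J f -> f x = 0) -> s x = 0) ->
  exists N, J (fun x => s x ^+ N).
Proof.
move=> [JX J0 JD JM] [q hq] h.
pose ev (p : {mpoly k[adim X]}) x := p.@[aemb X x 0].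
have [|v hv|N] := @nullstellensatz k (adim X) (fun p => J (ev p)) q.
- split=> [|p p' Jp Jp'|p p' Jp'].
  + by rewrite (_ : ev 0 = fun=> 0) //; apply: functional_extensionality => x;
      rewrite /ev meval0.
  + rewrite (_ : ev (p + p') = fun x => ev p x + ev p' x); first exact: JD.
    by apply: functional_extensionality => x; rewrite /ev mevalD.
  + rewrite (_ : ev (p * p') = fun x => ev p x * ev p' x); last first.
      by apply: functional_extensionality => x; rewrite /ev mevalM.
    by apply: JM => //; exists p.
- have [C hC] := aemb_closed X.
  have [x ex] : exists x, aemb X x = \row_i v i.
    apply/hC => p Cp; rewrite (meval_eq (v2 := v)) => [|i]; last by rewrite mxE.
    apply: hv; rewrite (_ : ev p = fun=> 0) //; apply: functional_extensionality => x.
    by apply: ((hC _).1 _ p Cp); exists x.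
  have ev_v p : ev p x = p.@[v].
    by rewrite /ev ex; apply: meval_eq => i; rewrite mxE.
  rewrite -ev_v /ev -hq; apply: h => f Jf; have [p hp] := JX f Jf.
  rewrite hp -/(ev p x) ev_v; apply: hv.
  by rewrite (_ : ev p = f) //; apply: functional_extensionality => y; rewrite hp.
- move=> JN; exists N; rewrite (_ : (fun x => _) = ev (q ^+ N)) //.
  by apply: functional_extensionality => x; rewrite /ev rmorphXn hq.
Qed.

(** The ideal generated by f has no zeros, hence contains a power of the constant 1. *)
Lemma regular_inv (f : T -> k) :
  regular X f -> (forall x, f x != 0) -> regular X (fun x => (f x)^-1).
Proof.
move=> hf f0.
pose J (q : T -> k) := exists2 r, regular X r & forall x, q x = f x * r x.
have [|||N [r hr e]] := @affine_nullstellensatz J (fun=> 1).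
- split.
  + move=> q [r hr e].
    by apply: eq_regular (regularM hf hr) => x; rewrite e.
  + by exists (fun=> 0); [apply: regular_const|move=> x; rewrite mulr0].
  + move=> q q' [r hr e] [r' hr' e']; exists (fun x => r x + r' x).
      exact: regularD.
    by move=> x; rewrite e e' mulrDr.
  + move=> p q hp [r hr e]; exists (fun x => p x * r x); first exact: regularM.
    by move=> x; rewrite e mulrCA.
- exact: regular_const.
- move=> x /(_ f) fx; case/eqP: (f0 x); apply: fx.
  by exists (fun=> 1); [apply: regular_const|move=> y; rewrite mulr1].
apply: eq_regular hr => x; apply: (mulfI (f0 x)).
by rewrite -e expr1n divff.
Qed.

End AffineNullstellensatz.

Section Units.
Context (k : closedFieldType) (M : algMonoid k) (d : M -> k).
Context (hd : is_determinant d).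
Local Notation O := (@regular_open k M (am_var M) (@am_unit k M)).

Lemma determinant_regular : coord_ring d.
Proof. by case: hd. Qed.

Lemma determinantM x y : d (x * y)%M = d x * d y.
Proof. by case: hd. Qed.

Lemma determinant_unit x : am_unit x <-> d x != 0.
Proof.
have [_ _ _ h] := hd; split=> [ux|/eqP d0]; first by apply/eqP => /h.
by apply: NNPP => /h.
Qed.

Lemma units_zopen : zopen (am_var M) (@am_unit k M).
Proof.
have [C hC] := zclosed_zeros determinant_regular; exists C => x.
by rewrite -hC; have [_ _ _ ->] := hd.
Qed.

(** The denominators of a form an ideal of k[M] whose zeros are all nonunits, where d vanishes; so
    some power of d is a denominator. *)
Lemma regular_openP (a : {x : M | am_unit x} -> k) : O a <->
  exists n p, coord_ring p /\ forall y, a y * d (sval y) ^+ n = p (sval y).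
Proof.
split=> [ha|[n [p [hp e]]] x]; last first.
  exists (@am_unit k M), p, (fun x => d x ^+ n); split=> //.
  - split; [exact: units_zopen|exact: svalP].
  - by split=> //; apply: regularX; apply: determinant_regular.
  - move=> y _; have dy : d (sval y) ^+ n != 0.
      by apply: expf_neq0; apply/determinant_unit; apply: svalP.
    by split=> //; rewrite -e mulfK.
pose J (q : M -> k) := coord_ring q /\ exists p, coord_ring p /\
  forall y, a y * q (sval y) = p (sval y).
have [|x hx|n [_ [p [hp e]]]] := @affine_nullstellensatz _ _ (am_var M) J d _
  determinant_regular.
- split.
  + by move=> f [].
  + split; first exact: regular_const.
    by exists (fun=> 0); split=> [|y]; [exact: regular_const|rewrite mulr0].
  + move=> f g [hf [p [hp ep]]] [hg [q [hq eq]]]; split; first exact: regularD.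
    exists (fun x => p x + q x); split=> [|y]; first exact: regularD.
    by rewrite mulrDr ep eq.
  + move=> f g hf [hg [q [hq eq]]]; split; first exact: regularM.
    exists (fun x => f x * q x); split=> [|y]; first exact: regularM.
    by rewrite mulrCA eq.
- apply/eqP/negP => /negP /determinant_unit ux.
  have [V [p [q [[[C hC] Vx] VU [hp hq] e]]]] := ha (exist _ x ux).
  (* c vanishes outside V but not at x; multiplying by it turns the local equation a q = p into one
     valid on all of G. *)
  have [c [Cc cx]] : exists c : {mpoly k[adim (am_var M)]}, C c /\ c.@[aemb (am_var M) x 0] != 0.
    apply: NNPP => h; apply: (hC x).2 Vx => c Cc; apply/eqP/negP => /negP c0.
    by apply: h; exists c.
  pose ev (y : M) := c.@[aemb (am_var M) y 0].
  have hev : coord_ring ev by exists c.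
  have [qx _] := e (exist _ x ux) Vx.
  suff /hx/eqP : J (fun y => ev y * q y).
    by rewrite mulf_eq0 (negbTE cx) (negbTE qx).
  split; first exact: regularM.
  exists (fun y => ev y * p y); split=> [|y]; first exact: regularM.
  have [Vy|nVy] := classic (V (sval y)).
    by have [qy ->] := e y Vy; rewrite mulrCA divfK.
  by rewrite /ev ((hC _).1 nVy c Cc) !mul0r mulr0.
- by exists n, p.
Qed.

End Units.

Section Subgroup.
Context (k : closedFieldType) (M : algMonoid k) (H : M -> Prop).
Context (hH : closed_subgroup H).
Local Notation S := (subgroup_monoid hH).

Lemma coord_ring_sub (f : M -> k) :
  coord_ring f -> coord_ring (fun x : S => f (sval x)).
Proof. by move=> [p hp]; exists p => x; apply: hp. Qed.

Lemma coord_ring_lift (f : S -> k) : coord_ring f ->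
  exists2 g : M -> k, coord_ring g & forall x, f x = g (sval x).
Proof.
move=> [p hp]; exists (fun x => p.@[aemb (am_var M) x 0]); first by exists p.
by move=> x; rewrite hp.
Qed.

Lemma subgroup_inv (x : S) : exists y : S, (x * y)%M = 1%M.
Proof.
have [y [xy yx]] := cs_unit hH (svalP x).
by exists (exist H y (cs_inv hH (svalP x) xy)); apply: S_eq.
Qed.

(** A nonzero value f m gives chi x = f (x m) / f m, so chi is regular and multiplicative; inverses
    in H keep it from vanishing. *)
Lemma extendible_semi_invariant (chi : S -> k) (f : M -> k) :
    coord_ring f -> (exists m, f m != 0) ->
    (forall (x : S) m, f (sval x * m)%M = chi x * f m) ->
  extendible chi.
Proof.
move=> hf [m fm] fE; split; last by exists f; split=> //; exists m.
have chiM x y : chi (x * y)%M = chi x * chi y.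
  by apply: (mulIf fm); rewrite -fE /= -am_mulA !fE mulrA.
have chi1 : chi 1%M = 1.
  by apply: (mulIf fm); rewrite -fE /= am_mul1m mul1r.
split=> // [|x].
  have h := regularM (regular_const _ (f m)^-1) (coord_ring_sub (coord_ring_rmul m hf)).
  by apply: eq_regular h => x; rewrite fE mulrC mulfK.
have [y xy] := subgroup_inv x; apply: contra_eqN chi1 => /eqP chix.
by rewrite -xy chiM chix mul0r eq_sym oner_eq0.
Qed.

Lemma character_inv (chi : S -> k) :
  is_character chi -> is_character (fun x => (chi x)^-1).
Proof.
move=> [hchi chi0 chiM]; split=> [|x|x y].
- exact: regular_inv.
- by rewrite invr_eq0.
- by rewrite chiM invfM.
Qed.

End Subgroup.

(** * Observability and semi-invariants *)

Lemma ideal_sum (k : closedFieldType) (T : Type) (A J : (T -> k) -> Prop)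
    (I : Type) (r : seq I) (u g : I -> T -> k) :
    is_ideal A J -> (forall i, A (u i)) -> (forall i, J (g i)) ->
  J (fun t => \sum_(i <- r) u i t * g i t).
Proof.
move=> [_ J0 JD JM] hu hg; elim: r => [|i r IHr].
  by rewrite (_ : (fun t => _) = fun=> 0) //; apply: functional_extensionality => t;
    rewrite big_nil.
rewrite (_ : (fun t => _) = fun t => u i t * g i t + \sum_(j <- r) u j t * g j t).
  by apply: JD => //; apply: JM.
by apply: functional_extensionality => t; rewrite big_cons.
Qed.

Section Equivalences.
Context (k : closedFieldType) (M : algMonoid k).
Context (irrM : zirreducible (am_var M)).
Context (H : M -> Prop) (hH : closed_subgroup H).
Local Notation S := (subgroup_monoid hH).

(** The semi-invariant is the determinant of the values of y at the points m p_j, nonzero at m = 1.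
    A general M-set [W] covers functions on M as well as tuples of them. *)
Lemma stable_det_extendible (W : Type) (act : M -> W -> W) m (y : W -> 'cV[k]_m)
    (delta : S -> 'M[k]_m) (p : 'I_m -> W) :
    (forall w, act 1%M w = w) ->
    (forall a b w, act (a * b)%M w = act a (act b w)) ->
    (forall w, regular_mx (am_var M) (fun x => y (act x w))) ->
    (forall (x : S) w, y (act (sval x) w) = delta x *m y w) ->
    values y p \in unitmx ->
  extendible (fun x => \det (delta x)).
Proof.
move=> act1 actM yreg yact up.
apply: (@extendible_semi_invariant _ _ _ hH _ (fun m => \det (values y (fun j => act m (p j))))).
- apply: regular_det => i j; apply: eq_regular (yreg (p j) i 0) => x.
  by rewrite mxE.
- exists 1%M; rewrite -unitfE -unitmxE (_ : values _ _ = values y p) //.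
  by apply/matrixP => i j; rewrite !mxE act1.
- move=> x m'; rewrite -det_mulmx -values_mul; congr (\det _).
  by apply/matrixP => i j; rewrite mxE actM yact [RHS]mxE.
Qed.

Definition inverses_extendible : Prop :=
  forall rho : S -> k, extendible rho -> extendible (fun x => (rho x)^-1).

Lemma observable_inverses : observable_monoid hH -> inverses_extendible.
Proof.
move=> obs rho [[_ rho0 _] [f [hf [m fm] fE]]].
(* The principal ideal of f is H-stable because f is semi-invariant. *)
pose I (u : M -> k) := exists2 g, coord_ring g & forall x, u x = f x * g x.
have [|||u [[g hg e] uE] [x ux]] := obs I.
- split.
  + by move=> u [g hg e]; apply: eq_regular (regularM hf hg) => x; rewrite e.
  + by exists (fun=> 0); [apply: regular_const|move=> x; rewrite mulr0].
  + move=> u u' [g hg e] [g' hg' e']; exists (fun x => g x + g' x).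
      exact: regularD.
    by move=> x; rewrite e e' mulrDr.
  + move=> p u hp [g hg e]; exists (fun x => p x * g x); first exact: regularM.
    by move=> x; rewrite e mulrCA.
- exists f; last by exists m.
  by exists (fun=> 1); [apply: regular_const|move=> x; rewrite mulr1].
- move=> s u [g hg e]; exists (fun x => rho s * g (sval s * x)%M).
    by apply: regularM; [apply: regular_const|apply: coord_ring_lmul].
  by move=> x; rewrite e fE -mulrA mulrCA.
apply: (extendible_semi_invariant hg).
  by exists x; move: ux; rewrite e mulf_eq0 negb_or => /andP[].
move=> s; suff z : forall m', g (sval s * m')%M - (rho s)^-1 * g m' = 0.
  by move=> m'; apply/subr0_eq.
move=> m'; apply/eqP/negP => /negP h.
(* Invariance of u = f g makes f times the defect vanish, so irreducibility forces the defect itself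
   to vanish. *)
have [|z] := @regular_domain _ _ _ f (fun m' => g (sval s * m')%M - (rho s)^-1 * g m')
  irrM hf _ (ex_intro _ m fm) (ex_intro _ m' h).
  apply: regularB; first exact: coord_ring_lmul.
  by apply: regularM => //; apply: regular_const.
case/eqP; apply: (mulfI (rho0 s)); rewrite mulr0 mulrBr mulrBr.
by rewrite mulrA -fE -e uE e mulrCA mulVKf // subrr.
Qed.

Lemma inverses_observable : inverses_extendible -> observable_monoid hH.
Proof.
move=> inv I hI [f If f0] Istable; have [IA _ _ IM] := hI.
have hf := IA f If.
have [d hd] := determinant_exists M.
have [m0 m0fd] : exists m, f m * d m != 0.
  apply: (regular_domain irrM hf (determinant_regular hd) f0).
  by exists 1%M; have [_ -> _ _] := hd; apply: oner_neq0.
have [fm0 /(determinant_unit hd)[m0' [m0m0' _]]] : f m0 != 0 /\ d m0 != 0.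
  by apply/andP; rewrite -negb_or -mulf_eq0.
pose act (x : S) (m : M) := (sval x * m)%M.
have act1 m : act 1%M m = m by apply: am_mul1m.
have actM x y m : act (x * y)%M m = act x (act y m) by apply/esym/am_mulA.
have [B] : inhabited (stable_basis act (fun _ : 'I_1 => f)).
  apply: stable_basis_exists => //.
  apply: (finrank_family (F := fun _ x w => f (act x w))) => _.
  exact: (finrank_comp (fun x : S => sval x) id (coord_ring_finrank hf)).
set g := sb_fun B; set G := values g (sb_pt (s := B)).
have uG : G \in unitmx by apply: sb_unit.
have Ig i : I (fun m => g m i 0).
  rewrite (_ : (fun m => _) = fun m => f (act (sb_shift i) m)); first exact: Istable.
  by apply: functional_extensionality => m; rewrite sb_funE.
have greg w : regular_mx (am_var M) (fun x => g (x * w)%M).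
  by move=> i j; rewrite ord1; exact: (coord_ring_rmul w (IA _ (Ig i))).
have gm0 : g m0 != 0.
  apply: contraNneq fm0 => gm0; have /colP/(_ 0) := sb_coefE B m0.
  by rewrite -/g gm0 mulmx0 !mxE => ->.
have ext := stable_det_extendible (@am_mul1m k M)
  (fun a b w => esym (am_mulA a b w)) greg (sb_act B) uG.
have [[_ chi0 _] _] := ext.
have [_ [h [hh hn hE]]] := inv _ ext.
(* Column q is evaluated at m, so expanding along it stays in [I]. The other columns are evaluated
   at m m0' p_j, which for m = m0 are the original points; hence the cofactors of column q are then
   those of [G]. *)
pose r (q j : 'I_(sb_dim B)) := if j == q then 1%M else (m0' * sb_pt j)%M.
pose R q m := values g (fun j => (m * r q j)%M).
have Rq q i m : R q m i q = g m i 0 by rewrite mxE /r eqxx am_mulm1.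
have Rcof q i : cofactor (R q m0) i q = cofactor G i q.
  congr (_ * \det _); apply/matrixP => a b; rewrite !mxE /r.
  by rewrite eq_sym (negbTE (neq_lift _ _)) am_mulA m0m0' am_mul1m.
(* If all these determinants vanished at m0, Cramer's rule would give [\adj G *m g m0 = 0], hence g
   m0 = 0. *)
have [q Fq] : exists q, \det (R q m0) != 0.
  apply: NNPP => noq; move/eqP: gm0; apply.
  have adj0 : \adj G *m g m0 = 0.
    apply/colP => q; rewrite !mxE; apply: NNPP => n0; apply: noq; exists q.
    apply/eqP => z; apply: n0; rewrite -[RHS]z (expand_det_col _ q).
    by apply: eq_bigr => i _; rewrite Rq Rcof mxE mulrC.
  have := congr1 (mulmx G) adj0; rewrite mulmxA mul_mx_adj mulmx0 mul_scalar_mx.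
  by move/eqP; rewrite scaler_eq0 -[_ == 0]negbK -unitfE -unitmxE uG => /eqP.
have Rreg : regular_mx (am_var M) (R q).
  by move=> i j; apply: eq_regular (greg (r q j) i 0) => m; rewrite mxE.
have IR : I (fun m => \det (R q m)).
  rewrite (_ : (fun m => _) = fun m => \sum_i cofactor (R q m) i q * g m i 0).
    apply: (@ideal_sum k M _ _ _ _ (fun i m => cofactor (R q m) i q)
      (fun i m => g m i 0) hI) => // i.
    apply: regularM; first exact: regular_const.
    apply: regular_det => a b; apply: eq_regular (Rreg (lift i a) (lift q b)) => m.
    by rewrite !mxE.
  apply: functional_extensionality => m; rewrite (expand_det_col _ q).
  by apply: eq_bigr => i _; rewrite Rq mulrC.
exists (fun m => h m * \det (R q m)).
  split=> [|x m]; first exact: IM.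
  rewrite hE (_ : R q _ = sb_mx B x *m R q m).
    by rewrite det_mulmx mulrACA mulVf ?mul1r.
  rewrite -values_mul; apply/matrixP => i j; rewrite mxE [RHS]mxE.
  by rewrite -am_mulA [g _](sb_act B x).
by apply: (regular_domain irrM hh (IA _ IR)) => //; exists m0.
Qed.

End Equivalences.

(** * Modules *)

Section Products.
Context (k : closedFieldType) (T U : Type) (X : affine k T) (Y : affine k U).

Lemma regular_fst (f : T -> k) : regular X f -> regular (affine_prod X Y) (fun z => f z.1).
Proof.
move=> [p hp]; apply: eq_regular (fun z => esym (hp z.1)) _.
apply: regular_meval => i.
apply: eq_regular (regular_coord (X := affine_prod X Y) (lshift _ i)) => z.
by rewrite /= /prod_emb row_mxEl.
Qed.

Lemma regular_snd (f : U -> k) : regular Y f -> regular (affine_prod X Y) (fun z => f z.2).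
Proof.
move=> [p hp]; apply: eq_regular (fun z => esym (hp z.2)) _.
apply: regular_meval => i.
apply: eq_regular (regular_coord (X := affine_prod X Y) (rshift _ i)) => z.
by rewrite /= /prod_emb row_mxEr.
Qed.

Lemma regular_section (f : T * U -> k) x :
  regular (affine_prod X Y) f -> regular Y (fun y => f (x, y)).
Proof.
move=> [p hp]; apply: eq_regular (fun y => esym (hp (x, y))) _.
apply: regular_meval => i; case: (split_ordP i) => j ->.
  apply: eq_regular (regular_const _ (aemb X x 0 j)) => y.
  by rewrite /= /prod_emb row_mxEl.
by apply: eq_regular (regular_coord j) => y; rewrite /= /prod_emb row_mxEr.
Qed.

End Products.

Section VectorSpaces.
Context (k : closedFieldType) (V : vectType k).
Local Notation coords := (passmx.rVof (vbasis {:V})).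

Lemma coords_sum (v : V) : v = \sum_i coords v 0 i *: (vbasis {:V})`_i.
Proof. by rewrite -[LHS](passmx.rVofK (fullv_basis V)). Qed.

Lemma regular_linear_form (phi : {linear V -> k^o}) : regular (affine_vect V) phi.
Proof.
have h : regular (affine_vect V) (fun v => \sum_i coords v 0 i * phi (vbasis {:V})`_i).
  apply: regular_sum => i; apply: regularM; last exact: regular_const.
  exact: (regular_coord (X := affine_vect V)).
by apply: eq_regular h => v; rewrite [v in RHS]coords_sum linear_sum;
  apply: eq_bigr => i _; rewrite linearZ.
Qed.

End VectorSpaces.

Section MatrixModule.
Context (k : closedFieldType) (N : algMonoid k) (m : nat) (a : N -> 'M[k]_m).
Context (areg : regular_mx (am_var N) a).
Context (a1 : a 1%M = 1%:M).
Context (aM : forall x y, a (x * y)%M = a x *m a y).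

Let act (v : 'rV[k]_m) x := v *m a x.

Let act_linear x : linear (act^~ x).
Proof. by move=> c u v; rewrite /act mulmxDl scalemxAl. Qed.

Let act1 v : act v 1%M = v.
Proof. by rewrite /act a1 mulmx1. Qed.

Let actM v x y : act v (x * y)%M = act (act v x) y.
Proof. by rewrite /act aM mulmxA. Qed.

Let act_morph : var_morphism (affine_prod (affine_vect 'rV[k]_m) (am_var N))
  (affine_vect 'rV[k]_m) (fun z => act z.1 z.2).
Proof.
move=> f [p hp]; apply: eq_regular (fun z => esym (hp _)) _.
apply: regular_meval => i /=.
(* The affine structure on row vectors uses coordinates in [vbasis]; [L] holds the constant
   coefficients expressing them through matrix entries. *)
pose L j := passmx.rVof (vbasis {:'rV[k]_m}) (delta_mx 0 j) 0 i.
have h : regular (affine_prod (affine_vect 'rV[k]_m) (am_var N))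
    (fun z => \sum_j act z.1 z.2 0 j * L j).
  apply: regular_sum => j; apply: regularM; last exact: regular_const.
  have h : regular (affine_prod (affine_vect 'rV[k]_m) (am_var N))
      (fun z : 'rV[k]_m * N => \sum_l z.1 0 l * a z.2 l j).
    apply: regular_sum => l; apply: regularM; last exact: regular_snd (areg l j).
    have lin : linear (fun v : 'rV[k]_m => v 0 l : k^o).
      by move=> c u v; rewrite !mxE.
    pose phi := HB.pack (fun v : 'rV[k]_m => v 0 l : k^o)
      (GRing.isLinear.Build _ _ _ _ _ lin) : {linear 'rV[k]_m -> k^o}.
    exact: (regular_fst _ (regular_linear_form phi)).
  by apply: eq_regular h => z; rewrite mxE.
apply: eq_regular h => z; rewrite [act _ _ in RHS]row_sum_delta linear_sum summxE.
by apply: eq_bigr => j _; rewrite linearZ [RHS]mxE.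
Qed.

Definition mx_module : ratModule N := RatModule act_linear act1 actM act_morph.

End MatrixModule.

Section LinearMaps.
Context (k : fieldType) (V W : lmodType k) (f : V -> W).
Context (lin_f : linear f).

Lemma linear_map0 : f 0 = 0.
Proof. by have := lin_f (-1) 0 0; rewrite scaler0 addr0 scaleN1r addNr. Qed.

Lemma linear_mapZ c v : f (c *: v) = c *: f v.
Proof. by have := lin_f c v 0; rewrite !addr0 linear_map0 addr0. Qed.

End LinearMaps.

(** * From modules to characters, and observability in the unit group *)

Section Equivalences.
Context (k : closedFieldType) (M : algMonoid k).
Context (irrM : zirreducible (am_var M)).
Context (H : M -> Prop) (hH : closed_subgroup H).
Local Notation S := (subgroup_monoid hH).

Definition modules_embed : Prop :=
  forall V : ratModule S, exists (W : ratModule M) (xi : V -> module_restriction hH W),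
    module_morphism xi /\ injective xi.

(** Regard chi as a one dimensional module and let w generate its image in W. A coordinate of m |->
    w m that is nonzero at 1 is semi-invariant of weight chi. *)
Lemma modules_embed_characters : modules_embed ->
  forall chi : S -> k, extendible chi <-> is_character chi.
Proof.
move=> emb chi; split=> [[]//|[hchi chi0 chiM]].
have chi1 : chi 1%M = 1.
  by apply: (mulIf (chi0 1%M)); rewrite -chiM am_mul1m mul1r.
have areg : regular_mx (am_var S) (fun x => (chi x)%:M : 'M[k]_1).
  by move=> i j; apply: eq_regular hchi => x; rewrite !ord1 mxE.
have a1 : (chi 1%M)%:M = 1%:M :> 'M[k]_1 by rewrite chi1.
have aM x y : (chi (x * y)%M)%:M = (chi x)%:M *m (chi y)%:M :> 'M[k]_1.
  by rewrite chiM scalar_mxM.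
have [W [xi [[xil xiE] xiI]]] := emb (mx_module areg a1 aM).
pose w := xi (1%:M : 'rV[k]_1).
have w0 : w != 0.
  apply/eqP => w0; have /eqP := xiI _ _ (etrans w0 (esym (linear_map0 xil))).
  by rewrite -[_ == 0]negbK oner_neq0.
have [i wi] : exists i, rVof (vbasis {:W}) w 0 i != 0.
  apply: NNPP => h; case/eqP: w0; rewrite (coords_sum w) big1 // => i _.
  have [->|ni] := eqVneq (rVof (vbasis {:W}) w 0 i) 0; first by rewrite scale0r.
  by case: h; exists i.
pose f m := rVof (vbasis {:W}) (rm_act (w : W) m) 0 i.
have fE (x : S) m : f (sval x * m)%M = chi x * f m.
  rewrite /f rm_actM -[rm_act _ (sval x)]xiE /=.
  rewrite mul1mx -scalemx1.
  by rewrite (linear_mapZ xil) (linear_mapZ (rm_linear m)) linearZ mxE.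
apply: (extendible_semi_invariant (f := f)) => //; last first.
  by exists 1%M; rewrite /f rm_act1.
have h := rm_morph (regular_coord (X := affine_vect W) i).
exact: (regular_section w h).
Qed.

Lemma characters_inverses :
  (forall chi : S -> k, extendible chi <-> is_character chi) -> inverses_extendible hH.
Proof. by move=> h rho /h/character_inv/h. Qed.

(** Contract the ideal to k[M]; clearing a power of d shows that the contraction is nonzero. An
    invariant found there remains nonzero on G by irreducibility. *)
Lemma observable_monoid_units : observable_monoid hH -> observable_units hH.
Proof.
move=> obs J [JO J0 JD JM] [h Jh [y hy]] Jstable.
have [d hd] := determinant_exists M.
pose res (f : M -> k) (y : {x : M | am_unit x}) := f (sval y).
have res_open f : coord_ring f ->
    @regular_open k M (am_var M) (@am_unit k M) (res f).
  move=> hf; apply/(regular_openP hd); exists 0%N, f; split=> // z.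
  by rewrite mulr1.
have [|||f [[hf Jf] finv] [x fx]] := obs (fun f => coord_ring f /\ J (res f)).
- split.
  + by move=> f [].
  + by split=> //; apply: regular_const.
  + by move=> f g [hf Jf] [hg Jg]; split; [apply: regularD|apply: JD].
  + move=> f g hf [hg Jg]; split; first exact: regularM.
    by apply: (JM (res f) (res g)) => //; apply: res_open.
- have [n [p [hp e]]] := (regular_openP hd h).1 (JO _ Jh).
  exists p; last first.
    exists (sval y); rewrite -e mulf_neq0 // expf_neq0 //.
    by apply/(determinant_unit hd); apply: svalP.
  split=> //; rewrite (_ : res p = fun z => res (fun x => d x ^+ n) z * h z).
    apply: JM => //; apply: res_open; apply: regularX; exact: (determinant_regular hd).
  by apply: functional_extensionality => z; rewrite /res -e mulrC.
- move=> s f [hf Jf]; split; first exact: coord_ring_lmul.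
  exact: Jstable s _ Jf.
have [m] : exists m, f m * d m != 0.
  apply: (regular_domain irrM hf (determinant_regular hd)); first by exists x.
  by exists 1%M; have [_ -> _ _] := hd; apply: oner_neq0.
rewrite mulf_eq0 negb_or => /andP[fm /(determinant_unit hd) um].
exists (res f); last by exists (exist _ m um).
by split=> // s z; apply: finv.
Qed.

Lemma inverse_determinant_extendible (d : M -> k) : inverses_extendible hH ->
  is_determinant d -> extendible (fun x : S => (d (sval x))^-1).
Proof.
move=> inv hd; apply: inv; apply: (extendible_semi_invariant (determinant_regular hd)).
  by exists 1%M; have [_ -> _ _] := hd; apply: oner_neq0.
by move=> x m; apply: (determinantM hd).
Qed.

(** Extend [I] to k[G]. An invariant p / d^n of the extension makes p semi-invariant of weight d^n,
    which multiplication by the n-th power of g, of weight 1/d, corrects. *)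
Lemma observable_units_monoid : observable_units hH ->
  (exists d : M -> k, is_determinant d /\ extendible (fun x : S => (d (sval x))^-1)) ->
  observable_monoid hH.
Proof.
move=> obs [d [hd [_ [g [hg [mg gmg] gE]]]]] I hI [f If [mf fmf]] Istable.
have [IA I0 ID IM] := hI.
have hd' := determinant_regular hd.
have dn0 n : exists m, d m ^+ n != 0.
  by exists 1%M; have [_ -> _ _] := hd; rewrite expr1n oner_neq0.
have dU (y : {x : M | am_unit x}) : d (sval y) != 0.
  by apply/(determinant_unit hd); apply: svalP.
have dS (x : S) : d (sval x) != 0.
  by apply/(determinant_unit hd); apply: (cs_unit hH (svalP x)).
pose J (h : {x : M | am_unit x} -> k) := exists n f, I f /\
  forall y, h y * d (sval y) ^+ n = f (sval y).
have [||s h [n [p [Ip e]]]|h [[n [p [Ip e]]] hinv] [y hy]] := obs J.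
- split.
  + move=> h [n [p [Ip e]]]; apply/(regular_openP hd); exists n, p.
    by split=> //; apply: IA.
  + by exists 0%N, (fun=> 0); split=> // y; rewrite mul0r.
  + move=> h h' [n [p [Ip e]]] [n' [p' [Ip' e']]].
    exists (n + n')%N, (fun x => d x ^+ n' * p x + d x ^+ n * p' x); split.
      by apply: ID; apply: IM => //; apply: regularX.
    move=> y; rewrite -e -e' exprD mulrDl.
    by congr (_ + _); [rewrite [RHS]mulrC mulrA|apply: mulrCA].
  + move=> a h /(regular_openP hd)[n [q [hq eq]]] [n' [p [Ip e]]].
    exists (n + n')%N, (fun x => q x * p x); split; first exact: IM.
    by move=> y; rewrite -e -eq exprD mulrACA.
- have [m] : exists m, f m * d m != 0.
    apply: (regular_domain irrM (IA _ If) hd'); first by exists mf.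
    by have := dn0 1%N.
  rewrite mulf_eq0 negb_or => /andP[fm /(determinant_unit hd) um].
  exists (fun y => f (sval y)); last by exists (exist _ m um).
  by exists 0%N, f; split=> // y; rewrite mulr1.
- exists n, (fun m => d (sval s) ^- n * p (sval s * m)%M); split.
    by apply: IM; [apply: regular_const|apply: Istable].
  move=> z; have := e (am_unit_lmul s z); rewrite /= => <-.
  by rewrite (determinantM hd) exprMn mulrCA mulKf // expf_neq0.
have hF : coord_ring (fun m => g m ^+ n * p m).
  by apply: regularM; [apply: regularX|apply: IA].
exists (fun m => g m ^+ n * p m); last first.
  apply: (regular_domain irrM); [exact: regularX|exact: IA| |].
    by exists mg; rewrite expf_neq0.
  by exists (sval y); rewrite -e mulf_neq0 // expf_neq0.
split=> [|x m]; first by apply: IM => //; apply: regularX.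
have pE z : am_unit z -> p (sval x * z)%M = d (sval x) ^+ n * p z.
  move=> uz; have /= <- := e (am_unit_lmul x (exist _ z uz)).
  have /= <- := e (exist _ z uz).
  by rewrite hinv (determinantM hd) exprMn mulrCA.
(* The weight of p is known at units only; by irreducibility a nonzero defect would be nonzero at
   some unit. *)
apply/subr0_eq/eqP/negP => /negP nz.
have hFx : coord_ring (fun m => g (sval x * m)%M ^+ n * p (sval x * m)%M - g m ^+ n * p m).
  by apply: regularB => //; apply: (coord_ring_lmul (sval x) hF).
have [z] := regular_domain irrM hFx hd' (ex_intro _ m nz) (dn0 1%N).
rewrite mulf_eq0 negb_or => /andP[nzz /(determinant_unit hd) uz].
case/eqP: nzz; rewrite gE pE // exprMn mulrACA -exprMn mulVf //.
by rewrite expr1n mul1r subrr.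
Qed.

End Equivalences.

(** * Embedding modules of H into modules of M *)

(** Cofactors along the first row do not see that row, so zeroing it there exhibits the determinant
    as a linear form in r. *)
Lemma det_col_mx_row (R : comNzRingType) d (r : 'rV[R]_(1 + d)) (Y : 'M[R]_(d, 1 + d)) :
  \det (col_mx r Y : 'M_(1 + d)) =
  (r *m \col_l cofactor (col_mx 0 Y : 'M_(1 + d)) (lshift d 0) l) 0 0.
Proof.
rewrite (expand_det_row _ (lshift d 0)) mxE; apply: eq_bigr => l _.
rewrite col_mxEu mxE; congr (_ * (_ * \det _)); apply/matrixP => i j.
rewrite [LHS]mxE [LHS]mxE [RHS]mxE [RHS]mxE.
have -> : lift (lshift d 0) i = rshift 1 i by apply: val_inj; rewrite /= /bump.
by rewrite !col_mxEd.
Qed.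

(** The product of [B] with the invertible matrix of values has full row rank; d independent columns
    select the points. *)
Lemma row_free_values (k : fieldType) (W : Type) m d (g : W -> 'cV[k]_m)
    (p : 'I_m -> W) (B : 'M[k]_(d, m)) :
  values g p \in unitmx -> row_free B ->
  exists q : 'I_d -> W, values (fun w => B *m g w) q \in unitmx.
Proof.
move=> uG fB.
have fBG : row_full (B *m values g p)^T.
  rewrite /row_full mxrank_tr mxrankMfree ?row_free_unit //.
exists (fun l => p (fullrankfun fBG l)); rewrite values_mul -unitmx_tr.
rewrite (_ : _^T = rowsub (fullrankfun fBG) (B *m values g p)^T) ?fullrowsub_unit //.
apply/matrixP => i j; rewrite !mxE; apply: eq_bigr => l _.
by rewrite !mxE.
Qed.

Section Embedding.
Context (k : closedFieldType) (M : algMonoid k).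
Context (irrM : zirreducible (am_var M)).
Context (H : M -> Prop) (hH : closed_subgroup H).
Local Notation S := (subgroup_monoid hH).

Section Representation.
Context (n : nat) (T : S -> 'M[k]_n).
Context (Treg : regular_mx (am_var S) T).
Context (T1 : T 1%M = 1%:M).
Context (TM : forall x y, T (x * y)%M = T x *m T y).

(** Sending u to w |-> u Phi(w) embeds the row module of [T] H-equivariantly into functions on M x
    P, inside a finite dimensional space stable under M. *)
Lemma equivariant_family : inverses_extendible hH ->
  exists (P : Type) (Phi : M * P -> 'cV[k]_n),
    [/\ forall p, regular_mx (am_var M) (fun m => Phi (m, p)),
        forall j, finrank (fun x (w : M * P) => Phi ((x * w.1)%M, w.2) j 0),
        forall (x : S) w, Phi ((sval x * w.1)%M, w.2) = T x *m Phi w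
      & forall u : 'rV_n, u != 0 -> exists w, u *m Phi w != 0].
Proof.
move=> inv.
have [F /all_and2[Freg FE]] : exists F : 'I_n * 'I_n -> M -> k, forall jt,
    coord_ring (F jt) /\ forall x, T x jt.1 jt.2 = F jt (sval x).
  apply: (@fin_all_exists _ (fun=> M -> k) (fun jt g =>
    coord_ring g /\ forall x, T x jt.1 jt.2 = g (sval x))) => jt.
  by have [g hg e] := coord_ring_lift (Treg jt.1 jt.2); exists g.
(* A function on [W] is an n-tuple of functions on M; [f j] is row j of the lifted entries of
   [T]. *)
pose W := ('I_n * M)%type.
pose act (x : M) (w : W) := (w.1, (x * w.2)%M).
pose f j (w : W) := F (j, w.1) w.2.
have act1 w : act 1%M w = w by case: w => i m; rewrite /act am_mul1m.
have actM x y w : act (x * y)%M w = act x (act y w) by rewrite /act am_mulA.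
have [B] : inhabited (stable_basis (fun (x : S) w => act (sval x) w) f).
  apply: stable_basis_exists => [|x y w|]; [exact: act1|exact: actM|].
  apply: (finrank_family (F := fun j (x : S) w => f j (act (sval x) w))) => j.
  exact: (finrank_comp (fun x : S => sval x) id (finrank_familyr
    (fun t => coord_ring_finrank (Freg (j, t))))).
set m := sb_dim B; pose g := sb_fun B; pose a := sb_mx B; pose b := sb_coef B.
have uG : values g (sb_pt (s := B)) \in unitmx := sb_unit B.
have gact (x : S) w : g (act (sval x) w) = a x *m g w := sb_act B x w.
(* Restriction to H. Since [gH x = c *m T x], a combination z g vanishes on H exactly when z c = 0,
   and [c] identifies Z/Y with the given module. *)
pose gH (x : S) := values g (fun t => (t, sval x)).
pose c := \matrix_(i, t) T (sb_shift i) (sb_idx i) t : 'M[k]_(m, n).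
have gHE x : gH x = c *m T x.
  apply/matrixP => i t; rewrite mxE [LHS]sb_funE /f /act /=.
  rewrite -(FE (_, _) (sb_shift i * x)%M) TM !mxE.
  by apply: eq_bigr => l _; rewrite mxE.
have TE x : T x = b *m gH x.
  rewrite -values_mul; apply/matrixP => j t.
  by rewrite mxE -sb_coefE mxE /f -(FE (j, t) x).
have bc : b *m c = 1%:M by have := TE 1%M; rewrite gHE T1 mulmx1.
have ac x : a x *m c = c *m T x.
  have h : gH x = a x *m gH 1%M.
    rewrite -values_mul; apply/matrixP => i t; rewrite mxE [RHS]mxE.
    by rewrite -gact /act /= am_mulm1.
  by rewrite -gHE h gHE T1 mulmx1.
(* The rows of [K] are a basis of Y, and [delta] is the matrix of the action on it. *)
pose K := row_base (kermx c).
have Kc : K *m c = 0 by apply/sub_kermxP; rewrite eq_row_base.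
have kerK l (Z : 'M_(l, m)) : Z *m c = 0 -> exists N, Z = N *m K.
  by move=> /sub_kermxP h; apply/submxP; rewrite eq_row_base.
have [K' KK'] := row_freeP (row_base_free (kermx c)).
pose d := \rank (kermx c); pose delta x := K *m a x *m K'.
have Kact x : K *m a x = delta x *m K.
  have [|N e] := kerK _ (K *m a x).
    by rewrite -mulmxA ac mulmxA Kc mul0mx.
  by rewrite /delta e -[_ *m K *m K']mulmxA KK' mulmx1.
(* The rows of [b] are equivariant only modulo Y; the defect N K disappears in determinants that
   also contain the rows of [K]. *)
have bact x : exists N, b *m a x = T x *m b + N *m K.
  have [|N e] := kerK _ (b *m a x - T x *m b).
    by rewrite mulmxBl -!mulmxA ac bc mulmx1 mulmxA bc mul1mx subrr.
  by exists N; rewrite -e addrC subrK.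
have greg w : regular_mx (am_var M) (fun x => g (act x w)).
  move=> i j; rewrite ord1.
  have h := coord_ring_lmul (sval (sb_shift i)) (Freg (sb_idx i, w.1)).
  by apply: eq_regular (coord_ring_rmul w.2 h) => x; rewrite sb_funE.
have [p0 up0] : exists p0 : 'I_d -> W, values (fun w => K *m g w) p0 \in unitmx.
  exact: (row_free_values uG (row_base_free _)).
have ext : extendible (fun x => \det (delta x)).
  apply: (@stable_det_extendible _ _ _ hH _ act _ (fun w => K *m g w) delta p0) => //.
    by move=> w; apply: regular_mulmx (regular_mx_const _ K) (greg w).
  by move=> x w; rewrite gact [LHS]mulmxA [RHS]mulmxA Kact.
have [[_ chi0 _] _] := ext.
have [_ [s [sreg [ms sms] sE]]] := inv _ ext.
pose E m' (p : 'I_(1 + d) -> W) := values g (fun l => act m' (p l)).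
have Ereg p : regular_mx (am_var M) (E^~ p).
  by move=> i l; apply: eq_regular (greg (p l) i 0) => x; rewrite mxE.
have Eact (x : S) m' p : E (sval x * m')%M p = a x *m E m' p.
  rewrite -values_mul; apply/matrixP => i l.
  by rewrite mxE actM gact [RHS]mxE.
pose D (u : 'rV_n) (w : M * ('I_(1 + d) -> W)) :=
  \det (col_mx (u *m b) K *m E w.1 w.2).
pose Phi (w : M * ('I_(1 + d) -> W)) := s w.1 *: (b *m E w.1 w.2 *m
  \col_l cofactor (col_mx 0 (K *m E w.1 w.2) : 'M_(1 + d)) (lshift d 0) l).
have PhiE u w : (u *m Phi w) 0 0 = s w.1 * D u w.
  by rewrite -scalemxAr mxE /D mul_col_mx det_col_mx_row -!mulmxA.
have PhiE' j w : Phi w j 0 = s w.1 * D (delta_mx 0 j) w.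
  by rewrite -PhiE -rowE [RHS]mxE.
exists ('I_(1 + d) -> W)%type, Phi; split.
- move=> p j i; rewrite ord1; apply: eq_regular (fun x => esym (PhiE' j _)) _.
  apply: regularM => //=; apply: regular_det; 
  exact: regular_mulmx (regular_mx_const _ _) (Ereg p).
- move=> j; apply: eq_finrank (fun x w => esym (PhiE' j _)) _.
  apply: finrankM; first exact: (finrank_comp id fst (coord_ring_finrank sreg)).
  apply: finrank_det => i l /=.
  apply: finrank_const_mulmx => r.
  have h t := coord_ring_finrank (coord_ring_lmul (sval (sb_shift r)) (Freg (sb_idx r, t))).
  apply: eq_finrank (finrank_comp id
    (fun w : M * ('I_(1 + d) -> W) => ((w.2 l).1, (w.1 * (w.2 l).2)%M))
    (finrank_familyr h)) => x w.
  by rewrite mxE [RHS]sb_funE /f /act /= !am_mulA.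
- move=> x w; apply/row_matrixP => j; rewrite rowE [RHS]rowE mulmxA.
  set u := delta_mx 0 j; apply/rowP => i; rewrite ord1 {i} !PhiE /= sE.
  have [N eN] := bact x.
  (* Translation by x acts by a block triangular row operation, contributing the factor det (delta
     x) that the weight of s cancels. *)
  have -> : D u ((sval x * w.1)%M, w.2) = \det (delta x) * D (u *m T x) w.
    rewrite /D /= Eact mulmxA mul_col_mx Kact -[u *m b *m _]mulmxA eN.
    have -> : col_mx (u *m (T x *m b + N *m K)) (delta x *m K) =
        block_mx 1%:M (u *m N) 0 (delta x) *m col_mx (u *m T x *m b) K.
      by rewrite mul_block_col mul1mx mul0mx add0r mulmxDr !mulmxA.
    by rewrite -mulmxA det_mulmx det_ublock det1 mul1r.
  by rewrite mulrACA mulVf // mul1r.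
- move=> u u0.
  have [u' uu'] : exists u', u *m u' = 1%:M.
    by apply/row_freeP; rewrite /row_free rank_rV u0.
  have fuK : row_free (col_mx (u *m b) K).
    (* [c *m u'] pairs to 1 with u b and to 0 with [K]; the correction of [K'] makes the second
       block pair to 0 with u b. *)
    apply/row_freeP; exists (row_mx (c *m u') (K' - c *m b *m K')).
    rewrite mul_col_row !mulmxBr !mulmxA -[u *m b *m c]mulmxA bc mulmx1 uu' Kc.
    by rewrite KK' !mul0mx subr0 subrr -scalar_mx_block.
  have [p up] := row_free_values uG fuK.
  have [m' ne0] : exists m', s m' * D u (m', p) != 0.
    apply: (regular_domain irrM sreg); last 2 first.
    + by exists ms.
    + exists 1%M; rewrite -unitfE -unitmxE /E -values_mul.
      rewrite (_ : values _ _ = values (fun w => col_mx (u *m b) K *m g w) p) //.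
      by apply/matrixP => i l; rewrite mxE act1 [RHS]mxE.
    apply: regular_det; exact: regular_mulmx (regular_mx_const _ _) (Ereg p).
  exists (m', p); apply: contraNneq ne0 => /matrixP/(_ 0 0).
  by rewrite PhiE mxE => ->.
Qed.

(** [beta] expresses the components of [Phi] in a basis of their M-span: equivariance of [Phi] gives
    the intertwining relation, separation gives injectivity. *)
Lemma matrix_representation_extends : inverses_extendible hH ->
  exists m (a : M -> 'M[k]_m) (beta : 'M[k]_(n, m)),
    [/\ regular_mx (am_var M) a, a 1%M = 1%:M,
        forall x y, a (x * y)%M = a x *m a y,
        forall x : S, T x *m beta = beta *m a (sval x)
      & forall u : 'rV_n, u *m beta = 0 -> u = 0].
Proof.
move=> /equivariant_family[P [Phi [Phireg Phifin PhiH Phi0]]].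
pose act (x : M) (w : M * P) := ((x * w.1)%M, w.2).
have act1 w : act 1%M w = w by case: w => m p; rewrite /act am_mul1m.
have actM x y w : act (x * y)%M w = act x (act y w) by rewrite /act am_mulA.
pose f j w := Phi w j 0.
have [B] : inhabited (stable_basis act f).
  exact: (stable_basis_exists act1 actM (finrank_family Phifin)).
have PhiE w : Phi w = sb_coef B *m sb_fun B w.
  by rewrite -sb_coefE; apply/colP => j; rewrite mxE.
exists (sb_dim B), (sb_mx B), (sb_coef B); split.
- apply: sb_mx_regular => // j [m p].
  exact: (coord_ring_rmul m (Phireg p j 0)).
- exact: sb_mx1.
- exact: sb_mxM.
- move=> x; apply: mulmx_values_inj (sb_unit B) _ => w.
  by rewrite -mulmxA -PhiE -PhiH -mulmxA -sb_act -PhiE.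
- move=> u ub; apply/eqP/negP => /negP /Phi0[w].
  by rewrite PhiE mulmxA ub mul0mx eqxx.
Qed.

End Representation.

Lemma inverses_modules_embed : inverses_extendible hH -> modules_embed hH.
Proof.
move=> inv V; set n := \dim {:V}.
pose e (j : 'I_n) := (vbasis {:V})`_j.
pose T (x : S) : 'M[k]_n := \matrix_j rVof (vbasis {:V}) (rm_act (e j) x).
have actE v x : rVof (vbasis {:V}) (rm_act v x) = rVof (vbasis {:V}) v *m T x.
  pose phi := HB.pack (fun v : V => rm_act v x)
    (GRing.isLinear.Build _ _ _ _ _ (rm_linear (r := V) x)) : {linear V -> V}.
  rewrite {1}(coords_sum v) -[rm_act _ x]/(phi _) !linear_sum mulmx_sum_row.
  by apply: eq_bigr => j _; rewrite !linearZ rowK.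
have Treg : regular_mx (am_var S) T.
  move=> j t; have h := rm_morph (r := V) (regular_coord (X := affine_vect V) t).
  by apply: eq_regular (regular_section (e j) h) => x; rewrite [RHS]mxE.
have T1 : T 1%M = 1%:M.
  apply/row_matrixP => j; rewrite rowK rm_act1 rowE mulmx1.
  exact: (rVofE (fullv_basis V)).
have TM x y : T (x * y)%M = T x *m T y.
  by apply/row_matrixP => j; rewrite row_mul !rowK rm_actM actE.
have [m [a [beta [areg a1 aM eq inj]]]] := matrix_representation_extends Treg T1 TM inv.
exists (mx_module areg a1 aM), (fun v => rVof (vbasis {:V}) v *m beta); split; last first.
  move=> v w /eqP; rewrite -subr_eq0 -mulmxBl -linearB => /eqP/inj/eqP.
  by rewrite (rVof_eq0 (fullv_basis V)) subr_eq0 => /eqP.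
split=> [c v w|v x]; first by rewrite linearP mulmxDl scalemxAl.
by rewrite actE -mulmxA eq mulmxA.
Qed.

End Embedding.

Theorem theorem3p4 (k : closedFieldType) (M : algMonoid k)
    (irrM : zirreducible (am_var M))
    (H : M -> Prop) (hH : closed_subgroup H) :
  [<-> (* (1) *) observable_monoid hH;
       (* (2) *) forall rho : subgroup_monoid hH -> k,
                   extendible rho -> extendible (fun x => (rho x)^-1);
       (* (3) *) forall chi : subgroup_monoid hH -> k, extendible chi <-> is_character chi;
       (* (4) *) forall V : ratModule (subgroup_monoid hH),
                   exists (W : ratModule M) (xi : V -> module_restriction hH W),
                     module_morphism xi /\ injective xi;
       (* (5), for any determinant *)
                 observable_units hH /\
                 forall d : M -> k, is_determinant d ->
                   extendible (fun x : subgroup_monoid hH => (d (sval x))^-1);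
       (* (5), for some determinant *)
                 observable_units hH /\
                 exists d : M -> k, is_determinant d /\
                   extendible (fun x : subgroup_monoid hH => (d (sval x))^-1)].
Proof.
tfae.
- exact: observable_inverses.
(* The step from (2) to (3) passes through (4), applied to one dimensional modules. *)
- by move=> inv; apply/modules_embed_characters/inverses_modules_embed.
- by move=> chars; apply: (inverses_modules_embed irrM); apply: characters_inverses.
- move=> /modules_embed_characters/characters_inverses inv; split.
    exact: observable_monoid_units (inverses_observable irrM inv).
  by move=> d; apply: inverse_determinant_extendible.
- move=> [obs any]; split=> //; have [d hd] := determinant_exists M.
  by exists d; split=> //; apply: any.
- by move=> [obs]; apply: observable_units_monoid.
Qed.
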